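(* Let $G=(V,w,m,d_0)$ be a salami (with respect to the combinatorial distance $d_0$) with bounded geometry. Then there exists a constant $C$ (depending only on $G$) such that for every $x_0\in V$, every $R>0$ and every positive harmonic function $u$ on $B_R(x_0)$, $$|\nabla u|(x_0)\le\frac{C}{R}\,u(x_0).$$
   Context: A graph $G=(V,w,m,d_0)$ consists of a countable set $V$, a symmetric function $w:V\times V\to[0,\infty)$ vanishing on the diagonal, a function $m:V\to(0,\infty)$; write $x\sim y$ if $w(x,y)>0$, $E=\{(x,y):w(x,y)>0\}$, $E(X,Y)=E\cap(X\times Y)$, $m(X)=\sum_{x\in X}m(x)$. The graph is locally finite (every vertex has finitely many neighbours) and connected; $d_0(x,y)=\inf\{n:x=x_0\sim\dots\sim x_n=y\}$, $B_R(x)=\{y:d_0(x,y)\le R\}$. Laplacian: $\Delta f(x)=\frac1{m(x)}\sum_y w(x,y)(f(y)-f(x))$. $Lip(1)=\{f\in\mathbb{R}^V: f(y)-f(x)\le d_0(x,y)\ \forall x,y\}$. Ollivier curvature for $x\ne y$: $\kappa(x,y)=\frac1{d_0(x,y)}\inf\{\Delta f(x)-\Delta f(y): f\in Lip(1),\ f(y)-f(x)=d_0(x,y)\}$. Non-negative Ollivier curvature means $\kappa(x,y)\ge0$ for all $x\sim y$. A salami partition is a triple $(X,Y,K)$ with $V=X\,\dot\cup\,Y\,\dot\cup\,K$ (disjoint), $K$ finite, $E(X,Y)=\emptyset$, $m(X)=m(Y)=\infty$. A salami (with distance $d_0$) is a connected, locally finite graph with non-negative Ollivier curvature admitting a salami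 partition. Bounded geometry: there exist $0<c<C'$ such that $c<m(x)<C'$, $c<w(x,y)<C'$ and $\mathrm{Deg}(x):=\frac1{m(x)}\sum_y w(x,y)<C'$ for all $x\sim y$. $|\nabla u|(x)=\max_{y\sim x}|u(y)-u(x)|$ (as $d_0(x,y)=1$ for $x\sim y$). A positive harmonic function on $B_R(x_0)$ is a function $u:B_{R+1}(x_0)\to(0,\infty)$ with $\Delta u(x)=0$ for all $x\in B_R(x_0)$. *)

(* Defs.v *)
From mathcomp Require Import all_boot all_order all_algebra.
From mathcomp Require Import finmap.
From mathcomp Require Import all_classical all_reals all_analysis.

Set Implicit Arguments.
Unset Strict Implicit.
Unset Printing Implicit Defensive.

Import Order.TTheory GRing.Theory Num.Theory.

Local Open Scope classical_set_scope.
Local Open Scope ring_scope.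

Record wgraph (R : realType) (V : countType) := WGraph {
  weight : V -> V -> R;
  vmeas : V -> R;
  weight_ge0 : forall x y, 0 <= weight x y;
  weight_sym : forall x y, weight x y = weight y x;
  weight_diag : forall x, weight x x = 0;
  vmeas_gt0 : forall x, 0 < vmeas x;
  locally_finite : forall x, finite_set [set y | 0 < weight x y];
  graph_connected : forall x y, exists p : seq V,
    path (fun a b => 0 < weight a b) x p /\ last x p = y
}.

Section Defs.
Variables (R : realType) (V : countType) (G : wgraph R V).

Definition adj : rel V := fun x y => 0 < weight G x y.

Definition edges (X Y : set V) : set (V * V) :=
  [set e | adj e.1 e.2] `&` (X `*` Y).

Definition measure_of (X : set V) : \bar R := \esum_(x in X) (vmeas G x)%:E.

Lemma ex_walk_length (x y : V) : exists n : nat,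
  `[< exists p : seq V, [/\ path adj x p, last x p = y & size p = n] >].
Proof.
have [p [px py]] := graph_connected G x y.
by exists (size p); apply/asboolP; exists p.
Qed.

(* Connectedness makes the set of walk lengths nonempty, so that the infimum
   is a minimum of naturals. *)
Definition d0 (x y : V) : nat := ex_minn (ex_walk_length x y).

Definition ball0 (x : V) (r : R) : set V := [set y | (d0 x y)%:R <= r].

(* By local finiteness the sums below have finite support. *)
Definition laplacian (f : V -> R) (x : V) : R :=
  (vmeas G x)^-1 * \sum_(y \in [set: V]) (weight G x y * (f y - f x)).

Definition degree (x : V) : R :=
  (vmeas G x)^-1 * \sum_(y \in [set: V]) weight G x y.

Definition Lip1 : set (V -> R) :=
  [set f | forall x y, f y - f x <= (d0 x y)%:R].

Definition Lip1_steepest (x y : V) : set (V -> R) :=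
  [set f | Lip1 f /\ f y - f x = (d0 x y)%:R].

(* Meaningful for x != y only. *)
Definition ollivier (x y : V) : \bar R :=
  (((d0 x y)%:R^-1)%R%:E *
   ereal_inf [set (laplacian f x - laplacian f y)%R%:E | f in Lip1_steepest x y])%E.

Definition nonneg_ollivier : Prop := forall x y, adj x y -> (0 <= ollivier x y)%E.

Definition salami_partition (X Y K : set V) : Prop :=
  [/\ X `|` Y `|` K = setT,
      [/\ X `&` Y = set0, X `&` K = set0 & Y `&` K = set0],
      finite_set K,
      edges X Y = set0
    & measure_of X = +oo%E /\ measure_of Y = +oo%E].

(* Connectedness and local finiteness are part of [wgraph]. *)
Definition salami : Prop :=
  nonneg_ollivier /\ exists X Y K, salami_partition X Y K.

Definition bounded_geometry : Prop :=
  exists c C' : R, 0 < c < C' /\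
    forall x y, adj x y ->
      [/\ c < vmeas G x < C', c < weight G x y < C' & degree x < C'].

(* The default value 0 is harmless since all terms are nonnegative. *)
Definition gradient (u : V -> R) (x : V) : R :=
  \big[Order.max/0]_(y <- fset_set [set y | adj x y]) `|u y - u x|.

(* A function on [ball0 x0 (r + 1)] is represented by a total function whose
   values outside that ball are irrelevant: all neighbours of a vertex of
   [ball0 x0 r] lie in [ball0 x0 (r + 1)]. *)
Definition positive_harmonic (x0 : V) (r : R) (u : V -> R) : Prop :=
  (forall x, ball0 x0 (r + 1) x -> 0 < u x) /\
  (forall x, ball0 x0 r x -> laplacian u x = 0).

End Defs.

(* Main.v *)
Require Import Defs.
From mathcomp Require Import all_boot all_order all_algebra.
From mathcomp Require Import finmap.
From mathcomp Require Import all_classical all_reals all_analysis.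
From mathcomp Require Import ring lra zify.

(** Let [X], [Y] be the two sides of a finite connected separator [K]. Among the
  Lipschitz functions which are extended from [K] in the smallest way to [X]
  and in the largest way to [Y], choose one maximising the minimum of its
  Laplacian over [K]. Non-negative curvature makes the flow [f + t * L f]
  preserve Lipschitz functions and spreads strict inequalities, so that the
  Laplacian is constant on [K]; by the same curvature bound it is at least this
  constant on [X] and at most this constant on [Y], and as both sides have
  infinite mass while the flux through [K] is finite, the constant is [0]. If an
  interior vertex [e] of [K] had no neighbour with value [f e + 1], or none with
  value [f e - 1], then re-extending such an [f] from [K] minus [e] and running
  the flow would contradict the same flux argument. Green's formula
  then bounds the number of vertices of each layer [t <= f <= t + 1] by a
  constant depending only on the salami.

  Linear volume growth turns the logarithmic Caccioppoli inequality into a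
  Harnack inequality on balls. The gradient estimate follows by using
  [|f - f x0|] as a barrier: the oscillation of [u] decays linearly in the
  radius over any range of radii in which the ball around [x0] meets no new
  vertex of the layer of [x0], and new vertices appear a bounded number of
  times. *)

Set Implicit Arguments.
Unset Strict Implicit.
Unset Printing Implicit Defensive.

Import Order.TTheory GRing.Theory Num.Theory.
Import numFieldNormedType.Exports.
Local Open Scope classical_set_scope.
Local Open Scope ring_scope.

(** * Maxima, bounds and sums over finite sequences *)

Section FiniteSequences.
Variables (R : realType) (T : eqType).

Lemma seq_argmax (s : seq T) (F : T -> R) x0 : x0 \in s ->
  exists2 x, x \in s & forall y, y \in s -> F y <= F x.
Proof.
elim: s x0 => // a s IH x0 _; case: s IH => [|b s] IH.
  by exists a; rewrite ?mem_head // => y; rewrite inE => /eqP ->.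
have [x xs hx] := IH b (mem_head _ _).
have [le|/ltW le] := leP (F a) (F x).
  exists x; first by rewrite inE xs orbT.
  by move=> y; rewrite inE => /predU1P[-> //|]; exact: hx.
exists a; first exact: mem_head.
by move=> y; rewrite inE => /predU1P[-> //|/hx /le_trans]; exact.
Qed.

Lemma seq_bound (s : seq T) (P : T -> nat -> Prop) :
  (forall x, x \in s -> exists n, P x n) ->
  exists N, forall x, x \in s -> exists2 n, (n <= N)%N & P x n.
Proof.
elim: s => [|a s IH] h; first by exists 0%N.
have [N hN] := IH (fun x xs => h x (mem_behead (s := a :: s) xs)).
have [n hn] := h a (mem_head _ _).
exists (maxn n N) => x; rewrite inE => /predU1P[->|/hN[k kN Pk]].
  by exists n; rewrite ?leq_maxl.
by exists k; rewrite // leq_max kN orbT.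
Qed.

Lemma seq_real_bound (s : seq T) (F : T -> R) :
  exists n : nat, forall x, x \in s -> F x <= n%:R.
Proof.
have [|N hN] := @seq_bound s (fun x n => F x <= n%:R).
  move=> x _; exists (Num.trunc (F x)).+1; exact/ltW/truncnS_gt.
by exists N => x /hN[n nN] /le_trans; apply; rewrite ler_nat.
Qed.

Lemma ler_sum_sub (r s : seq T) (F : T -> R) : uniq r -> {subset r <= s} ->
  (forall x, 0 <= F x) -> \sum_(x <- r) F x <= \sum_(x <- s) F x.
Proof.
move=> + + F0; elim: r s => [|a r IH] s /=.
  by rewrite big_nil sumr_ge0.
move=> /andP[ar ur] sub; rewrite big_cons [leRHS](big_rem a) /=; last first.
  by apply: sub; rewrite mem_head.
rewrite lerD2l; apply: IH => // x xr; apply: rem_mem.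
  by apply: contraNneq ar => <-.
by apply: sub; rewrite inE xr orbT.
Qed.

End FiniteSequences.

(** Peel off the slab [f <= a + 1] and recurse on the rest, which starts at height [a + 1]. The
    bound counts [k.+1] slabs because the base case [k = 0] already uses one. *)
Lemma size_layers (R : realType) (T : eqType) (f : T -> R) (s : seq T)
    (N : nat) (a : R) (k : nat) :
  uniq s ->
  (forall (t : R) A, uniq A -> {subset A <= s} ->
     (forall z, z \in A -> t <= f z <= t + 1) -> (size A <= N)%N) ->
  (forall z, z \in s -> a <= f z <= a + k%:R) -> (size s <= N * k.+1)%N.
Proof.
elim: k a s => [|k IH] a s us hN hs.
  rewrite muln1; apply: (hN a s us) => // z /hs.
  by rewrite addr0; lra.
pose low := [seq z <- s | f z <= a + 1].
pose high := [seq z <- s | ~~ (f z <= a + 1)].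
have -> : size s = (size low + size high)%N.
  by rewrite !size_filter count_predC.
rewrite mulnS leq_add //.
  apply: (hN a); first exact: filter_uniq.
    by move=> z; rewrite mem_filter => /andP[].
  by move=> z; rewrite mem_filter => /andP[fz /hs]; rewrite fz; case/andP => ->.
apply: (IH (a + 1)); first exact: filter_uniq.
  move=> t A uA sA; apply: hN => // z /sA.
  by rewrite mem_filter => /andP[].
move=> z; rewrite mem_filter -ltNge => /andP[fz /hs].
by rewrite -natr1; lra.
Qed.

(** * Truncation and elementary inequalities for ratios of positive reals *)

Section RealInequalities.
Variable R : realType.
Implicit Types a b s t : R.

(** Cuts the height [s] off to the layer from [t] to [t + 1]. It gives the test function of the flux
    and layer estimates and, with [t = 0], the radial cutoff of the Caccioppoli inequality. *)
Definition clamp (t s : R) : R := Num.max 0 (Num.min 1 (s - t)).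

Lemma clamp_ge0 t s : 0 <= clamp t s.
Proof. by rewrite /clamp le_max lexx. Qed.

Lemma clamp_le1 t s : clamp t s <= 1.
Proof. by rewrite /clamp ge_max ler01 ge_min lexx. Qed.

Lemma clamp0 t s : s <= t -> clamp t s = 0.
Proof.
move=> h; rewrite /clamp; apply/max_idPl; rewrite ge_min.
by rewrite subr_le0 h orbT.
Qed.

Lemma clamp1 t s : t + 1 <= s -> clamp t s = 1.
Proof.
move=> h; rewrite /clamp (min_idPl _); last by lra.
by apply/max_idPr.
Qed.

Lemma clamp_mid t s : t <= s -> s <= t + 1 -> clamp t s = s - t.
Proof.
move=> h1 h2; rewrite /clamp (min_idPr _); last by lra.
by apply/max_idPr; lra.
Qed.

Lemma clamp_mono t s1 s2 : s1 <= s2 -> clamp t s1 <= clamp t s2.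
Proof.
by move=> h; rewrite /clamp le_max2 // le_min2 // lerD2r.
Qed.

Lemma clamp_prod_ge0 t s1 s2 : 0 <= (s2 - s1) * (clamp t s2 - clamp t s1).
Proof.
have [h|/ltW h] := leP s1 s2.
  by rewrite mulr_ge0 ?subr_ge0 ?clamp_mono.
by rewrite mulr_le0 ?subr_le0 ?clamp_mono.
Qed.

Lemma clamp_lip t a b : (clamp t a - clamp t b) ^+ 2 <= (a - b) ^+ 2.
Proof.
rewrite -[leLHS]real_normK ?num_real // -[leRHS]real_normK ?num_real //.
apply: lerXn2r; rewrite ?nnegrE ?normr_ge0 //.
wlog ab : a b / b <= a => [hw|].
  have [/hw //|/ltW /hw] := leP b a.
  by rewrite distrC (distrC a b).
rewrite ger0_norm ?subr_ge0 ?clamp_mono // ger0_norm ?subr_ge0 //.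
have [bt|tb] := leP b t.
  rewrite (clamp0 bt) subr0; have [aT|ta] := leP a t.
    by rewrite clamp0 // subr_ge0.
  have [a1|a1] := leP a (t + 1); first by rewrite clamp_mid ?(ltW ta) //; lra.
  by rewrite clamp1 ?(ltW a1) //; lra.
have [a1|a1] := leP a (t + 1).
  by rewrite !clamp_mid ?(ltW tb) //; lra.
rewrite clamp1 ?(ltW a1) //; have [b1|b1] := leP b (t + 1).
  by rewrite clamp_mid ?(ltW tb) //; lra.
by rewrite clamp1 ?(ltW b1) // subrr subr_ge0.
Qed.

(* With [q = sqrt (b / a)] the fraction is [(q - 1 / q) ^+ 2]; by AM-GM the
   exponent is at least [2 * (q - 1 / q) >= 2 * (q - 1)]. *)
Lemma ratio_le_expR a b t : 0 < a -> 0 < b -> 0 < t ->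
  b <= a * expR (t + (b - a) ^+ 2 / (a * b) / t).
Proof.
move=> a0 b0 t0; set s := (b - a) ^+ 2 / (a * b).
have s0 : 0 <= s by rewrite divr_ge0 ?sqr_ge0 // mulr_ge0 ?ltW.
pose x := t + s / t.
have x0 : 0 <= x.
  by apply: addr_ge0; [exact: ltW | apply: divr_ge0 => //; exact: ltW].
have e1 : 1 <= expR x by apply: le_trans (expR_ge1Dx x); lra.
have [ba|ab] := leP b a.
  by apply: le_trans ba _; rewrite ler_peMr // ltW.
pose p := b / a; pose q := Num.sqrt p.
have p1 : 1 <= p by rewrite /p ler_pdivlMr // mul1r ltW.
have qq : q ^+ 2 = p by rewrite sqr_sqrtr // (le_trans _ p1).
have q1 : 1 <= q by rewrite -sqrtr1 ler_sqrt // (le_trans _ p1).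
have q0 : 0 < q by lra.
have sE : s = (q - q^-1) ^+ 2.
  have bE : b = a * q ^+ 2 by rewrite qq /p; field; rewrite gt_eqF.
  by rewrite /s bE; field; rewrite !gt_eqF.
have xs : (2 * (q - q^-1)) ^+ 2 <= x ^+ 2.
  rewrite -subr_ge0.
  have -> : x ^+ 2 - (2 * (q - q^-1)) ^+ 2 = (t - s / t) ^+ 2.
    have -> : (2 * (q - q^-1)) ^+ 2 = 4 * s by rewrite sE; ring.
    by rewrite /x; field; rewrite gt_eqF.
  exact: sqr_ge0.
have qi : q^-1 <= 1 by rewrite invf_le1.
have xq : 2 * (q - q^-1) <= x.
  by move: xs; rewrite ler_sqr ?nnegrE //; lra.
have h : q <= expR (x / 2).
  by apply: le_trans (expR_ge1Dx _); lra.
have : p <= expR x.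
  have -> : expR x = expR (x / 2) ^+ 2.
    by rewrite expr2 -expRD; congr expR; field.
  by rewrite -qq; apply: lerXn2r; rewrite ?nnegrE ?expR_ge0 // ltW.
by rewrite /p ler_pdivrMr // mulrC.
Qed.

(** Discrete Picone inequality: the right side minus the left is the square
    [(be * a - al * b) ^+ 2 / (a * b)]. *)
Lemma log_energy_le (a b al be : R) : 0 < a -> 0 < b ->
  (b - a) * (be ^+ 2 / b - al ^+ 2 / a) <= (be - al) ^+ 2.
Proof.
move=> a0 b0; rewrite -subr_ge0.
have -> : (be - al) ^+ 2 - (b - a) * (be ^+ 2 / b - al ^+ 2 / a)
    = (be * a - al * b) ^+ 2 / (a * b).
  by field; rewrite !gt_eqF.
by rewrite divr_ge0 ?sqr_ge0 // mulr_ge0 ?ltW.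
Qed.

End RealInequalities.

(** * Distance, Laplacian and curvature *)

Section Graph.
Variables (R : realType) (V : countType) (G : wgraph R V).
Local Notation w := (weight G).
Local Notation m := (vmeas G).
Local Notation d := (d0 G).
Local Notation L := (laplacian G).
Implicit Types (f g : V -> R) (x y z : V) (K : seq V).

Lemma adj_sym x y : adj G x y = adj G y x.
Proof. by rewrite /adj weight_sym. Qed.

Lemma adj_irr x y : adj G x y -> x != y.
Proof. by apply: contraTneq => ->; rewrite /adj weight_diag ltxx. Qed.

Lemma weight_nadj x y : ~~ adj G x y -> w x y = 0.
Proof.
by rewrite /adj -leNgt => h; apply/eqP; rewrite eq_le h weight_ge0.
Qed.

Definition nbrs x : seq V := fset_set [set y | adj G x y].

Lemma mem_nbrs x y : (y \in nbrs x) = adj G x y.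
Proof.
rewrite /nbrs; have := in_fset_set (locally_finite G x) y.
by rewrite -/(adj G x) => ->; apply/idP/idP; rewrite inE.
Qed.

Lemma nbrs_uniq x : uniq (nbrs x).
Proof. exact: fset_uniq. Qed.

Lemma d_walk x y : exists p,
  [/\ path (adj G) x p, last x p = y & size p = d x y].
Proof. by rewrite /d0; case: ex_minnP => n /asboolP. Qed.

Lemma d_le_walk x p : path (adj G) x p -> (d x (last x p) <= size p)%N.
Proof.
move=> xp; rewrite /d0; case: ex_minnP => n _; apply; apply/asboolP.
by exists p.
Qed.

Lemma dxx x : d x x = 0%N.
Proof. by apply/eqP; rewrite -leqn0; exact: (@d_le_walk x [::]). Qed.

Lemma d_eq0 x y : d x y = 0%N -> x = y.
Proof. by have [[|z p] [_ py ps]] := d_walk x y => // h; rewrite h in ps. Qed.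

Lemma d_triangle y x z : (d x z <= d x y + d y z)%N.
Proof.
have [p [xp py <-]] := d_walk x y; have [q [yq qz <-]] := d_walk y z.
rewrite -size_cat; have -> : z = last x (p ++ q) by rewrite last_cat py.
by apply: d_le_walk; rewrite cat_path xp py.
Qed.

Lemma d_sym x y : d x y = d y x.
Proof.
have le a b : (d a b <= d b a)%N.
  have [p [bp pa <-]] := d_walk b a.
  have -> : size p = size (rev (belast b p)) by rewrite size_rev size_belast.
  have {1}-> : b = last a (rev (belast b p)).
    by rewrite -pa; case: {bp pa} p => //= c p; rewrite rev_cons last_rcons.
  apply: d_le_walk; rewrite -pa rev_path.
  by rewrite (eq_path (e' := adj G)) // => u v; exact: adj_sym.
by apply/eqP; rewrite eqn_leq !le.
Qed.

Lemma d_adj x y : adj G x y -> d x y = 1%N.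
Proof.
move=> a; apply/eqP; rewrite eqn_leq; apply/andP; split.
  by have := @d_le_walk x [:: y]; rewrite /= a; exact.
by rewrite lt0n; apply: contraTneq (adj_irr a) => /d_eq0 ->; rewrite eqxx.
Qed.

Lemma d_step x y n : d x y = n.+1 -> exists2 z, adj G x z & d z y = n.
Proof.
move=> dn; have [[|z p] [xp py ps]] := d_walk x y; first by rewrite dn in ps.
move: xp py ps => /= /andP[a zp] py [ps]; exists z => //.
have h1 := d_le_walk zp; rewrite py in h1.
have h2 := d_triangle z x y; rewrite (d_adj a) in h2.
by rewrite dn in ps h2; lia.
Qed.

Lemma d_step_r x y n : d x y = n.+1 -> exists2 z, adj G z y & d x z = n.
Proof.
rewrite d_sym => /d_step[z a h]; exists z; first by rewrite adj_sym.
by rewrite d_sym.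
Qed.

(** Balls are duplicate-free lists, which local finiteness permits, so that they can index finite
    sums and be counted. *)
Fixpoint dball x n : seq V :=
  if n is k.+1 then undup (dball x k ++ flatten [seq nbrs y | y <- dball x k])
  else [:: x].

Lemma dball_uniq x n : uniq (dball x n).
Proof. by case: n => //= n; exact: undup_uniq. Qed.

Lemma mem_dball x n y : (y \in dball x n) = (d x y <= n)%N.
Proof.
elim: n y => [|n IH] y /=.
  rewrite inE leqn0; apply/eqP/eqP => [->|/d_eq0 //]; exact: dxx.
rewrite mem_undup mem_cat IH; apply/orP/idP.
  case=> [/leqW //|/flattenP[s /mapP[z]]]; rewrite IH => dz ->.
  rewrite mem_nbrs => a; have := d_triangle z x y; rewrite (d_adj a).
  by lia.
rewrite leq_eqVlt => /predU1P[dn|]; last by rewrite ltnS; left.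
have [z a dz] := d_step_r dn; right; apply/flattenP; exists (nbrs z).
  by apply/mapP; exists z; rewrite // IH dz.
by rewrite mem_nbrs.
Qed.

Lemma dball_center x n : x \in dball x n.
Proof. by rewrite mem_dball dxx. Qed.

Lemma sub_dball x k n : (k <= n)%N -> {subset dball x k <= dball x n}.
Proof. by move=> kn y; rewrite !mem_dball => /leq_trans; exact. Qed.

Lemma dball_nbr x n y z : y \in dball x n -> adj G y z -> z \in dball x n.+1.
Proof.
rewrite !mem_dball => h a; have := d_triangle y x z; rewrite (d_adj a); lia.
Qed.

(** Terms off the neighbours of [x] vanish. The freedom in [r] lets all vertices of a finite window
    share one index list, as summation by parts requires. *)
Lemma wsum x (r : seq V) (F : V -> R) : uniq r -> {subset nbrs x <= r} ->
  \sum_(y \in [set: V]) (w x y * F y) = \sum_(y <- r) w x y * F y.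
Proof.
move=> ur sr; rewrite (fsbigE r) //.
  by apply: eq_bigl => y; rewrite in_setT.
move=> y _ /negP yr; rewrite weight_nadj ?mul0r //; apply/negP => a.
by apply: yr; apply: sr; rewrite mem_nbrs.
Qed.

Lemma laplacianE r f x : uniq r -> {subset nbrs x <= r} ->
  L f x = (m x)^-1 * \sum_(y <- r) w x y * (f y - f x).
Proof. by move=> ur sr; rewrite /laplacian (wsum _ ur). Qed.

Lemma laplacian_nbrs f x :
  L f x = (m x)^-1 * \sum_(y <- nbrs x) w x y * (f y - f x).
Proof. by apply: laplacianE; rewrite ?nbrs_uniq. Qed.

Lemma degreeE r x : uniq r -> {subset nbrs x <= r} ->
  degree G x = (m x)^-1 * \sum_(y <- r) w x y.
Proof.
move=> ur sr; rewrite /degree; congr (_ * _).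
transitivity (\sum_(y \in [set: V]) (w x y * 1)).
  by apply: eq_fsbigr => y _; rewrite mulr1.
rewrite (wsum (fun=> 1) ur sr).
by apply: eq_bigr => y _; rewrite mulr1.
Qed.

Lemma laplacianD f g x : L (fun z => f z + g z) x = L f x + L g x.
Proof.
rewrite !laplacian_nbrs -mulrDr -big_split; congr (_ * _).
by apply: eq_bigr => y _ /=; ring.
Qed.

Lemma laplacianZ a f x : L (fun z => a * f z) x = a * L f x.
Proof.
rewrite !laplacian_nbrs mulrCA; congr (_ * _); rewrite mulr_sumr.
by apply: eq_bigr => y _; ring.
Qed.

Lemma laplacianN f x : L (fun z => - f z) x = - L f x.
Proof.
rewrite -mulN1r -laplacianZ; congr (L _ x); apply/funext => z.
by rewrite mulN1r.
Qed.

Lemma laplacianB f g x : L (fun z => f z - g z) x = L f x - L g x.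
Proof. by rewrite laplacianD laplacianN. Qed.

Lemma laplacian_cst a x : L (fun=> a) x = 0.
Proof.
by rewrite laplacian_nbrs big1 ?mulr0 // => y _; rewrite subrr mulr0.
Qed.

Lemma eq_laplacian f g x : f x = g x -> (forall y, adj G x y -> f y = g y) ->
  L f x = L g x.
Proof.
move=> fx fy; rewrite !laplacian_nbrs; congr (_ * _).
rewrite big_seq [RHS]big_seq; apply: eq_bigr => y.
by rewrite mem_nbrs fx => /fy ->.
Qed.

Lemma vmeas_inv_gt0 x : 0 < (m x)^-1.
Proof. by rewrite invr_gt0 vmeas_gt0. Qed.

Lemma laplacian_ge f a x : (forall y, adj G x y -> - a <= f y - f x) ->
  - (degree G x * a) <= L f x.
Proof.
move=> h; rewrite laplacian_nbrs (degreeE (nbrs_uniq x)) //.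
rewrite -mulrA -mulrN; apply: ler_wpM2l; first exact/ltW/vmeas_inv_gt0.
rewrite -mulrN mulr_suml big_seq [leRHS]big_seq; apply: ler_sum => y.
by rewrite mem_nbrs => a'; apply: ler_wpM2l; [exact: weight_ge0 | exact: h].
Qed.

Lemma laplacian_ge0 f x : (forall y, adj G x y -> f x <= f y) -> 0 <= L f x.
Proof.
move=> h; have := @laplacian_ge f 0 x; rewrite mulr0 oppr0; apply=> y a.
by rewrite subr_ge0 h.
Qed.

Lemma laplacian_gt0 f x y : (forall y, adj G x y -> f x <= f y) ->
  adj G x y -> f x < f y -> 0 < L f x.
Proof.
move=> h a fxy; rewrite laplacian_nbrs mulr_gt0 ?vmeas_inv_gt0 //.
rewrite (bigD1_seq y) ?mem_nbrs ?nbrs_uniq //= ltr_wpDr //; last first.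
  by rewrite mulr_gt0 ?subr_gt0.
rewrite big_seq_cond sumr_ge0 // => z /andP[]; rewrite mem_nbrs => /h fz _.
by rewrite mulr_ge0 ?weight_ge0 ?subr_ge0.
Qed.

Lemma Lip1_adj f : (forall x y, adj G x y -> f y - f x <= 1) -> Lip1 G f.
Proof.
move=> h x y; have [n] := ubnP (d x y); elim: n x y => // n IH x y.
case E : (d x y) => [|k] lt; first by rewrite (d_eq0 E) subrr.
have [z a dz] := d_step E.
have := IH z y; rewrite dz => /(_ lt) h1.
by rewrite -natr1; have := h _ _ a; lra.
Qed.

Lemma Lip1_abs f x y : Lip1 G f -> `|f y - f x| <= (d x y)%:R.
Proof.
move=> lf; have := lf x y; have := lf y x; rewrite (d_sym y x) ler_norml; lra.
Qed.

Lemma Lip1N f : Lip1 G f -> Lip1 G (fun z => - f z).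
Proof. by move=> lf x y; have := lf y x; rewrite (d_sym y x); lra. Qed.

Lemma Lip1_steep_step f x y n : Lip1 G f -> d x y = n.+1 ->
  f y - f x = (d x y)%:R ->
  exists z, [/\ adj G x z, f z - f x = 1 & f y - f z = (d z y)%:R].
Proof.
move=> lf dn e; have [z a dz] := d_step dn; exists z.
have := lf x z; have := lf z y; rewrite (d_adj a) dz => h1 h2.
by move: e; rewrite dn -natr1 => e; split => //; lra.
Qed.

Section Curvature.
Hypothesis curv : nonneg_ollivier G.

(** Such an [f] competes in the infimum that defines the curvature of the edge. *)
Lemma laplacian_steep_adj f x y : Lip1 G f -> adj G x y -> f y - f x = 1 ->
  L f y <= L f x.
Proof.
move=> lf a e; have := curv a; rewrite /ollivier (d_adj a) invr1 mul1e => h.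
rewrite -subr_ge0 -lee_fin; apply: le_trans h _.
by apply: ereal_inf_lbound; exists f => //; split => //; rewrite (d_adj a).
Qed.

(** A function steepest from [x] to [y] rises by exactly one on every edge of a geodesic, so the
    edge inequality chains along it. *)
Lemma laplacian_steep f x y : Lip1 G f -> f y - f x = (d x y)%:R ->
  L f y <= L f x.
Proof.
move=> lf; have [n] := ubnP (d x y); elim: n x y => // n IH x y.
case E : (d x y) => [|k] lt e; first by rewrite (d_eq0 E).
rewrite -E in e; have [z [a e1 e2]] := Lip1_steep_step lf E e.
have := laplacian_steep_adj lf a e1; apply: le_trans.
apply: IH => //; have := lf x z; rewrite (d_adj a) e1 => _.
have : (d z y)%:R + 1 = (d x y)%:R :> R by lra.
by rewrite natr1 E => /eqP; rewrite eqr_nat => /eqP; lia.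
Qed.

Variable D : R.
Hypothesis degD : forall x, degree G x <= D.
Hypothesis D_gt0 : 0 < D.

(* [f] is compared with [f' = max f (f x + 1 - d _ y)], which is steepest from
   [x] to [y] and exceeds [f] by at most the defect [1 - (f y - f x)]. *)
Lemma Lip1_flow f : Lip1 G f -> Lip1 G (fun z => f z + (2 * D)^-1 * L f z).
Proof.
move=> lf; apply: Lip1_adj => x y a.
pose s := 1 - (f y - f x).
have s0 : 0 <= s by have := lf x y; rewrite (d_adj a) /s; lra.
pose f' z := Num.max (f z) (f x + 1 - (d z y)%:R).
have f'x : f' x = f x by rewrite /f' (d_adj a) addrK maxxx.
have f'y : f' y = f y + s.
  rewrite /f' dxx subr0; have -> : f y + s = f x + 1 by rewrite /s; ring.
  by apply/max_idPr; rewrite /s in s0; lra.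
have ff' z : f z <= f' z by rewrite /f' le_max lexx.
have f'f z : f' z <= f z + s.
  rewrite /f' ge_max lerDl s0 /=.
  by have := lf z y; rewrite /s; lra.
have lf' : Lip1 G f'.
  move=> u v; rewrite lerBlDr /f' ge_max; apply/andP; split.
    have := lf u v; have := ff' u; rewrite /f'; lra.
  have : (d u y <= d u v + d v y)%N := d_triangle v u y.
  rewrite -(ler_nat R) natrD.
  have : f x + 1 - (d u y)%:R <= f' u by rewrite /f' le_max lexx orbT.
  by rewrite -/(f' u); lra.
have h := laplacian_steep_adj lf' a; rewrite f'x f'y in h.
have {}h : L f' y <= L f' x by apply: h; rewrite /s; lra.
have h1 : - (degree G y * s) <= L (fun z => f' z - f z) y.
  by apply: laplacian_ge => z _; have := ff' z; rewrite f'y; lra.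
have h2 : - (degree G x * s) <= L (fun z => f z - f' z) x.
  by apply: laplacian_ge => z _; have := f'f z; rewrite f'x; lra.
rewrite laplacianB in h1; rewrite laplacianB in h2.
have : degree G x * s <= D * s by rewrite ler_wpM2r.
have : degree G y * s <= D * s by rewrite ler_wpM2r.
move=> h3 h4.
(* The time step [(2 * D)^-1] is the one for which the Laplacian can use up at most the slack [s] of
   the edge. *)
have h5 : L f y - L f x <= 2 * D * s by lra.
have : (2 * D)^-1 * (L f y - L f x) <= s.
  by rewrite ler_pdivrMl ?mulr_gt0.
by rewrite /s; lra.
Qed.

End Curvature.
End Graph.

(** * Extremal Lipschitz functions *)

Section Separation.
Variables (R : realType) (V : countType) (G : wgraph R V).
Local Notation w := (weight G).
Local Notation m := (vmeas G).
Local Notation d := (d0 G).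
Local Notation L := (laplacian G).
Implicit Types (f g : V -> R) (x y z k : V) (K : seq V) (X Y : set V).

(** Green's formula on a finite window. Exchanging the sums and using the symmetry of [w] turns the
    [phi y] half into a second copy of the [phi x] half, hence the factor 2. *)
Lemma sum_by_parts (W : seq V) f (phi : V -> R) : uniq W ->
  (forall x, x \in W -> phi x != 0 -> {subset nbrs G x <= W}) ->
  \sum_(x <- W) \sum_(y <- W) w x y * (f y - f x) * (phi y - phi x)
  = - (2 * \sum_(x <- W) m x * phi x * L f x).
Proof.
move=> uW supp.
pose B := \sum_(x <- W) \sum_(y <- W) w x y * (f y - f x) * phi x.
have -> : \sum_(x <- W) m x * phi x * L f x = B.
  rewrite /B big_seq [RHS]big_seq; apply: eq_bigr => x xW.
  have [p0|pn0] := eqVneq (phi x) 0.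
    by rewrite p0 mulr0 mul0r big1 // => y _; rewrite mulr0.
  rewrite (laplacianE _ uW (supp x xW pn0)) -mulr_suml.
  have := vmeas_gt0 G x => /lt0r_neq0 m0; by field.
have -> : \sum_(x <- W) \sum_(y <- W) w x y * (f y - f x) * (phi y - phi x)
  = \sum_(x <- W) \sum_(y <- W) w x y * (f y - f x) * phi y - B.
  rewrite /B -sumrB; apply: eq_bigr => x _; rewrite -sumrB.
  by apply: eq_bigr => y _; ring.
rewrite exchange_big /=.
have -> : \sum_(j <- W) \sum_(i <- W) w i j * (f j - f i) * phi j = - B.
  rewrite /B -sumrN; apply: eq_bigr => x _; rewrite -sumrN.
  by apply: eq_bigr => y _; rewrite (weight_sym G y); ring.
by ring.
Qed.

(** [m k * degree G k] is the total weight of the edges at [k], so this bounds the flux of a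
    1-Lipschitz function through [K]. *)
Definition boundary_weight K := \sum_(k <- undup K) m k * degree G k.

Lemma degree_ge0 x : 0 <= degree G x.
Proof.
rewrite (degreeE (nbrs_uniq G x)) // mulr_ge0 ?(ltW (vmeas_inv_gt0 _ _)) //.
by rewrite sumr_ge0 // => y _; exact: weight_ge0.
Qed.

Lemma sum_weight_le (W : seq V) x : uniq W ->
  \sum_(y <- W) w x y <= m x * degree G x.
Proof.
move=> uW; rewrite (degreeE (undup_uniq (W ++ nbrs G x))); last first.
  by move=> y yx; rewrite mem_undup mem_cat yx orbT.
rewrite mulrA mulfV ?mul1r ?lt0r_neq0 ?vmeas_gt0 //.
apply: ler_sum_sub => // [y yW|y]; last exact: weight_ge0.
by rewrite mem_undup mem_cat yW.
Qed.

Lemma boundary_sum_le K (W : seq V) : uniq W ->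
  \sum_(x <- W) \sum_(y <- W) w x y * ((x \in K)%:R + (y \in K)%:R)
  <= 2 * boundary_weight K.
Proof.
move=> uW.
have le : \sum_(x <- W) \sum_(y <- W) w x y * (x \in K)%:R
    <= boundary_weight K.
  apply: le_trans (_ : \sum_(x <- W | x \in K) m x * degree G x <= _).
    rewrite [leRHS]big_mkcond /=; apply: ler_sum => x _.
    rewrite -mulr_suml; case: (x \in K); last by rewrite mulr0.
    by rewrite mulr1 sum_weight_le.
  rewrite -big_filter; apply: ler_sum_sub; first exact: filter_uniq.
    by move=> x; rewrite mem_filter mem_undup => /andP[].
  by move=> x; rewrite mulr_ge0 ?degree_ge0 ?(ltW (vmeas_gt0 _ _)).
have eq : \sum_(x <- W) \sum_(y <- W) w x y * (y \in K)%:R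
    = \sum_(x <- W) \sum_(y <- W) w x y * (x \in K)%:R.
  rewrite exchange_big /=; apply: eq_bigr => x _.
  by apply: eq_bigr => y _; rewrite weight_sym.
under eq_bigr do under eq_bigr do rewrite mulrDr.
under eq_bigr do rewrite big_split /=.
by rewrite big_split /= eq; lra.
Qed.

(** Infinite mass in terms of finite lists, the form that a finitely supported test function can
    exploit. *)
Definition infinite_mass X := forall A : R, exists F : seq V,
  [/\ uniq F, forall x, x \in F -> X x & A < \sum_(x <- F) m x].

Lemma infinite_massP X : measure_of G X = +oo%E -> infinite_mass X.
Proof.
rewrite /measure_of /esum => h A.
have : (A%:E < +oo)%E by rewrite ltry.
rewrite -h => /ereal_sup_gt[_ [F [finF FX] <-]] lt.
exists (fset_set F); split; first exact: fset_uniq.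
  by move=> x; rewrite in_fset_set // inE => /FX.
by move: lt; rewrite fsbig_finite //= sumEFin lte_fin.
Qed.

Lemma infinite_massD X K : infinite_mass X -> infinite_mass (X `\` [set` K]).
Proof.
move=> mX A; have [F [uF FX lt]] := mX (A + \sum_(k <- K) m k).
exists [seq x <- F | x \notin K]; split; first exact: filter_uniq.
  by move=> x; rewrite mem_filter => /andP[/negP xK /FX].
have : \sum_(x <- [seq x <- F | x \in K]) m x <= \sum_(k <- K) m k.
  apply: ler_sum_sub => [|x|x]; first exact: filter_uniq.
    by rewrite mem_filter => /andP[].
  exact/ltW/vmeas_gt0.
have E : \sum_(x <- F) m x = \sum_(x <- [seq x <- F | x \in K]) m x
    + \sum_(x <- [seq x <- F | x \notin K]) m x.
  by rewrite (bigID (mem K)) /= !big_filter.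
by rewrite E in lt; lra.
Qed.

Definition separates K X Y :=
  [/\ forall z, [\/ z \in K, X z | Y z],
      forall x, X x -> x \notin K, forall y, Y y -> y \notin K,
      forall z, X z -> ~ Y z
    & forall x y, X x -> Y y -> ~~ adj G x y].

Lemma separates_sym K X Y : separates K X Y -> separates K Y X.
Proof.
case=> h1 h2 h3 h4 h5; split => //.
- by move=> z; case: (h1 z) => h; [exact: Or31 | exact: Or33 | exact: Or32].
- by move=> z Yz /h4.
- by move=> x y Yx Xy; rewrite adj_sym h5.
Qed.

(** Follow a geodesic from [x]: since [X] and [Y] are not adjacent, it can leave [X] only by
    entering [K]. *)
Lemma separates_exit K X Y x y : separates K X Y -> X x -> ~ X y ->
  exists2 k, k \in K & d x y = (d x k + d k y)%N.
Proof.
move=> [cov _ _ _ XY]; have [n] := ubnP (d x y); elim: n x => // n IH x.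
case E : (d x y) => [|j] lt Xx nXy; first by rewrite (d_eq0 E) in Xx.
have [z a dz] := d_step E.
case: (cov z) => [zK|Xz|Yz].
- by exists z; rewrite // (d_adj a) dz.
- have [|k kK dk] := IH z _ Xz nXy; first by rewrite dz.
  exists k => //; rewrite dz in dk.
  have := d_triangle G z x k; have := d_triangle G k x y.
  rewrite (d_adj a) E; lia.
- by have := XY x z Xx Yz; rewrite a.
Qed.

(* Equivalently, [f] is the smallest Lipschitz extension of its restriction to
   [K] on [X] and the largest one on [Y]. *)
Definition extremal K X Y f :=
  [/\ Lip1 G f,
      forall x, X x -> exists2 k, k \in K & f k - f x = (d x k)%:R
    & forall y, Y y -> exists2 k, k \in K & f y - f k = (d k y)%:R].

Lemma extremalN K X Y f : extremal K X Y f -> extremal K Y X (fun z => - f z).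
Proof.
case=> lf hX hY; split; first exact: Lip1N.
  by move=> y /hY[k kK e]; exists k => //; rewrite d_sym -e; ring.
by move=> x /hX[k kK e]; exists k => //; rewrite d_sym -e; ring.
Qed.

(** McShane extensions from [K]: maximise [g k - d x k] over [k] for [x] in [X], and minimise
    [g k + d k y] for [y] in [Y]. *)
Lemma extremal_exists K X Y g k0 : separates K X Y -> k0 \in K -> Lip1 G g ->
  exists2 f, extremal K X Y f & forall k, k \in K -> f k = g k.
Proof.
move=> sep k0K lg; have [cov XK YK XnY XY] := sep.
pose PX x k := k \in K /\ forall j, j \in K ->
  g j - (d x j)%:R <= g k - (d x k)%:R.
pose PY y k := k \in K /\ forall j, j \in K ->
  g k + (d k y)%:R <= g j + (d j y)%:R.
have [kX hX] : {kX : V -> V & forall x, PX x (kX x)}.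
  apply: (@choice _ _ PX) => x.
  have [k kK h] := seq_argmax (fun j => g j - (d x j)%:R) k0K.
  by exists k.
have [kY hY] : {kY : V -> V & forall y, PY y (kY y)}.
  apply: (@choice _ _ PY) => y.
  have [k kK h] := seq_argmax (fun j => - (g j + (d j y)%:R)) k0K.
  by exists k; split => // j /h; rewrite lerN2.
pose f z := if z \in K then g z else
  if `[< X z >] then g (kX z) - (d z (kX z))%:R
  else g (kY z) + (d (kY z) z)%:R.
have fK k : k \in K -> f k = g k by rewrite /f => ->.
have fX x : X x -> f x = g (kX x) - (d x (kX x))%:R.
  by move=> Xx; rewrite /f (negbTE (XK _ Xx)) asboolT.
have fY y : Y y -> f y = g (kY y) + (d (kY y) y)%:R.
  move=> Yy; rewrite /f (negbTE (YK _ Yy)) asboolF // => Xy.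
  exact: (XnY y).
have fX_ge x k : X x -> k \in K -> g k - (d x k)%:R <= f x.
  by move=> Xx kK; rewrite fX //; apply: (hX x).2.
have fY_le y k : Y y -> k \in K -> f y <= g k + (d k y)%:R.
  by move=> Yy kK; rewrite fY //; apply: (hY y).2.
have tri x y z : (d x z)%:R <= (d x y)%:R + (d y z)%:R :> R.
  by rewrite -natrD ler_nat d_triangle.
exists f => //; split; last 2 first.
- move=> x Xx; exists (kX x); first exact: (hX x).1.
  by rewrite (fX x) // (fK _ (hX x).1); ring.
- move=> y Yy; exists (kY y); first exact: (hY y).1.
  by rewrite (fY y) // (fK _ (hY y).1); ring.
move=> x y; case: (cov x) => [xK|Xx|Yx]; case: (cov y) => [yK|Xy|Yy].
- by rewrite !fK.
- rewrite (fK x) // (fX y) //; have [yK _] := hX y.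
  have := lg x (kX y); have := tri x y (kX y); lra.
- by have := fY_le _ _ Yy xK; rewrite (fK x) //; lra.
- by have := fX_ge _ _ Xx yK; rewrite (fK y) //; lra.
- have [kK _] := hX y; have := fX_ge _ _ Xx kK; rewrite (fX y) //.
  by have := tri x y (kX y); lra.
(* From [X] to [Y] a geodesic meets [K] at some [k], and both extensions are compared with [g k]. *)
- have [k kK e] := separates_exit sep Xx (fun Xy => XnY y Xy Yy).
  have := fX_ge _ _ Xx kK; have := fY_le _ _ Yy kK.
  by rewrite e natrD; lra.
- have [kK _] := hY x; rewrite (fY x) // (fK y) //.
  by have := lg (kY x) y; have := tri (kY x) x y; lra.
- rewrite (fX y) // (fY x) //.
  have := lg (kY x) (kX y); have := tri (kY x) x (kX y).
  by have := tri x y (kX y); lra.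
- have [kK _] := hY x; have := fY_le _ _ Yy kK; rewrite (fY x) //.
  by have := tri (kY x) x y; lra.
Qed.

Section Flow.
Hypothesis curv : nonneg_ollivier G.
Variable D : R.
Hypothesis degD : forall x, degree G x <= D.
Hypothesis D_gt0 : 0 < D.

(** One time step of the flow, lowered at rate [l] and re-extended from [K]. Extremality of [f] on
    [X] and of [f1] on [Y] keeps [u = f1 - f] non-negative off [K] as well, so [L f1 >= l + D * u]
    on [K]; where [u] vanishes, a neighbour with [u > 0] still makes [L u] positive. *)
Lemma extremal_step K X Y f l k0 : separates K X Y -> k0 \in K ->
  extremal K X Y f -> (forall k, k \in K -> l <= L f k) ->
  exists f1, [/\ extremal K X Y f1, forall k, k \in K -> l <= L f1 k
    & forall k k', k \in K -> k' \in K -> k' = k \/ adj G k k' ->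
      l < L f k' -> l < L f1 k].
Proof.
move=> sep k0K [lf fX fY] lle.
pose g z := f z + (2 * D)^-1 * L f z - (2 * D)^-1 * l.
have lg : Lip1 G g.
  by move=> x y; have := Lip1_flow curv degD D_gt0 lf x y; rewrite /g; lra.
have [f1 ext1 f1K] := extremal_exists sep k0K lg.
have [lf1 f1X f1Y] := ext1.
have D2 : 0 < (2 * D)^-1 by rewrite invr_gt0 mulr_gt0.
pose u z := f1 z - f z.
have uK k : k \in K -> u k = (2 * D)^-1 * (L f k - l).
  by move=> kK; rewrite /u f1K // /g; ring.
have uK0 k : k \in K -> 0 <= u k.
  by move=> kK; rewrite uK // mulr_ge0 ?(ltW D2) // subr_ge0 lle.
have u0 z : 0 <= u z.
  have [cov _ _ _ _] := sep; rewrite /u.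
  case: (cov z) => [/uK0 //|/fX[k kK e]|/f1Y[k kK e]].
    by have := uK0 _ kK; have := lf1 z k; rewrite /u; lra.
  by have := uK0 _ kK; have := lf k z; rewrite /u; lra.
(* On [K] the choice of [g] amounts to [L f = l + 2 * D * u]. *)
have f1E k : k \in K -> L f1 k = l + 2 * D * u k + L u k.
  move=> kK; rewrite laplacianB uK //; have := lt0r_neq0 D_gt0 => Dn; by field.
have Lu k : - (D * u k) <= L u k.
  apply: le_trans (_ : - (degree G k * u k) <= _).
    by rewrite lerN2 ler_wpM2r.
  by apply: laplacian_ge => y _; have := u0 y; lra.
have ge k : k \in K -> l + D * u k <= L f1 k.
  by move=> kK; rewrite f1E //; have := Lu k; lra.
have gt0 k : k \in K -> l < L f k -> 0 < u k.
  by move=> kK lt; rewrite uK // mulr_gt0 // subr_gt0.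
have uk0 k : k \in K -> 0 < u k -> l < L f1 k.
  move=> kK u_gt; apply: lt_le_trans (ge _ kK).
  by rewrite ltrDl mulr_gt0.
exists f1; split => //.
  by move=> k kK; apply: le_trans (ge _ kK); rewrite lerDl mulr_ge0 // ltW.
move=> k k' kK k'K [->|a] lt; first by apply: uk0 => //; apply: gt0.
have := u0 k; rewrite le_eqVlt => /predU1P[uk|]; last exact: uk0.
rewrite f1E // -uk mulr0 addr0 ltrDl.
apply: (@laplacian_gt0 _ _ _ _ _ k') => //.
  by move=> y _; rewrite -uk.
by rewrite -uk gt0.
Qed.

(** Each step carries the strict inequality one edge further inside [K], and the paths needed for
    the finitely many vertices of [K] have bounded length. *)
Lemma extremal_spread K X Y f l k0 : separates K X Y -> k0 \in K ->
  extremal K X Y f -> (forall k, k \in K -> l <= L f k) ->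
  (forall k, k \in K -> exists p, [/\ path (adj G) k p, all (mem K) p
     & l < L f (last k p)]) ->
  exists2 f', extremal K X Y f' & forall k, k \in K -> l < L f' k.
Proof.
move=> sep k0K ext lle conn.
have iter n : exists f', [/\ extremal K X Y f',
    forall k, k \in K -> l <= L f' k
  & forall k p, k \in K -> path (adj G) k p -> all (mem K) p ->
    l < L f (last k p) -> (size p <= n)%N -> l < L f' k].
  elim: n => [|n [f' [ext' le' gt']]].
    by exists f; split => // k [|].
  have [f1 [ext1 le1 gt1]] := extremal_step sep k0K ext' le'.
  exists f1; split => // k [|k' p] kK /=.
    by move=> _ _ lt _; apply: (gt1 k k) => //; [left | apply: (gt' k [::])].
  move=> /andP[a kp] /andP[k'K pK] lt; rewrite ltnS => sp.
  by apply: (gt1 k k') => //; [right | apply: (gt' k' p)].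
have [|N hN] := @seq_bound V K (fun k n => exists p, [/\ path (adj G) k p,
    all (mem K) p, l < L f (last k p) & size p = n]).
  by move=> k /conn[p [h1 h2 h3]]; exists (size p), p.
have [f' [ext' _ gt']] := iter N; exists f' => // k kK.
have [n nN [p [h1 h2 h3 h4]]] := hN k kK.
by apply: (gt' k p) => //; rewrite h4.
Qed.

(** On [X] the value of [f] is some [f k] minus the distance to [k], so superlevel sets stay near
    [K]; this makes the truncated test functions finitely supported. *)
Lemma extremal_fin K X Y f t : extremal K X Y f ->
  exists n, forall x, X x -> t < f x -> exists2 k, k \in K & x \in dball G k n.
Proof.
case=> _ fX _; have [n hn] := seq_real_bound K (fun k => f k - t).
exists n => x /fX[k kK e] lt; exists k => //; rewrite mem_dball d_sym.
by rewrite -(ler_nat R) -e; apply: le_trans (hn k kK); lra.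
Qed.

(** By steepness [L f >= e] holds on all of [X]. Testing Green's formula with a truncation of [f] on
    [X] bounds [e] times the mass of any finite part of [X] by the boundary weight of [K]. *)
Lemma extremal_flux K X Y f (e : R) : separates K X Y -> infinite_mass X ->
  extremal K X Y f -> 0 < e -> (forall k, k \in K -> e <= L f k) -> False.
Proof.
move=> sep mX ext e0 ge; have [lf fX fY] := ext.
have [cov XK YK XnY XY] := sep.
have geX x : X x -> e <= L f x.
  by move=> /fX[k kK h]; apply: le_trans (ge k kK) (laplacian_steep curv lf h).
have [F [uF FX Flt]] := mX (boundary_weight K / e).
have [b hb] := seq_real_bound F (fun x => - f x).
(* So low that the truncation equals 1 on all of [F]. *)
pose t : R := - b%:R - 1.
pose phi x := if `[< X x >] then clamp t (f x) else 0.
have phi0 x : 0 <= phi x by rewrite /phi; case: ifP => // _; exact: clamp_ge0.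
have phiX x : X x -> phi x = clamp t (f x) by move=> h; rewrite /phi asboolT.
have phinX x : ~ X x -> phi x = 0 by move=> h; rewrite /phi asboolF.
have [n hn] := extremal_fin t ext.
pose W := undup (flatten [seq dball G k n.+1 | k <- K] ++ F).
have uW : uniq W by exact: undup_uniq.
have supp x : x \in W -> phi x != 0 -> {subset nbrs G x <= W}.
  move=> _; have [Xx|/phinX ->] := pselect (X x); last by rewrite eqxx.
  rewrite phiX // => cn0.
  have : t < f x by rewrite ltNge; apply: contraNN cn0 => /clamp0 ->.
  move=> /(hn x Xx)[k kK xb] y; rewrite mem_nbrs => a.
  rewrite mem_undup mem_cat; apply/orP; left.
  apply/flattenP; exists (dball G k n.+1); last exact: dball_nbr a.
  by apply/mapP; exists k.
have := sum_by_parts f uW supp.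
set S := \sum_(x <- W) _ => SE.
have S_ge : - (2 * boundary_weight K) <= S.
  apply: le_trans (_ : - \sum_(x <- W) \sum_(y <- W)
    w x y * ((x \in K)%:R + (y \in K)%:R) <= _).
    by rewrite lerN2 boundary_sum_le.
  rewrite /S -sumrN; apply: ler_sum => x _; rewrite -sumrN.
  apply: ler_sum => y _.
  have [a|/weight_nadj ->] := boolP (adj G x y); last by rewrite !mul0r oppr0.
  rewrite -mulrN -mulrA; apply: ler_wpM2l; first exact: weight_ge0.
  have l1 := lf x y; have l2 := lf y x.
  rewrite (d_adj a) in l1; rewrite d_sym (d_adj a) in l2.
  (* Inside [X] the integrand is non-negative because [clamp] is monotone. An edge leaving [X] ends
     in [K], and this endpoint pays for a loss of at most one. *)
  have [Xx|nXx] := pselect (X x); have [Xy|nXy] := pselect (X y).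
  - rewrite !phiX //; apply: le_trans (clamp_prod_ge0 t (f x) (f y)).
    by rewrite oppr_le0 addr_ge0 ?ler0n.
  - rewrite (phinX y) // phiX //.
    have yK : y \in K.
      by case: (cov y) => // Yy; have := XY _ _ Xx Yy; rewrite a.
    rewrite yK; have := clamp_ge0 t (f x); have := clamp_le1 t (f x).
    have : 0 <= (x \in K)%:R :> R by rewrite ler0n.
    have -> : true%:R = 1 :> R by [].
    have : 0 <= (1 - (f y - f x)) * clamp t (f x).
      by rewrite mulr_ge0 ?clamp_ge0 //; lra.
    lra.
  - rewrite (phinX x) // phiX //.
    have xK : x \in K.
      case: (cov x) => // Yx; have := XY _ _ Xy Yx.
      by rewrite adj_sym a.
    rewrite xK; have := clamp_ge0 t (f y); have := clamp_le1 t (f y).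
    have : 0 <= (y \in K)%:R :> R by rewrite ler0n.
    have -> : true%:R = 1 :> R by [].
    have : 0 <= (1 + (f y - f x)) * clamp t (f y).
      by rewrite mulr_ge0 ?clamp_ge0 //; lra.
    lra.
  - by rewrite !phinX // subrr mulr0 oppr_le0 addr_ge0 ?ler0n.
have S2 : \sum_(x <- F) m x * e <= \sum_(x <- W) m x * phi x * L f x.
  apply: le_trans (_ : \sum_(x <- F) m x * phi x * L f x <= _).
    rewrite big_seq [leRHS]big_seq; apply: ler_sum => x xF.
    have Xx := FX _ xF.
    rewrite (phiX x) // clamp1 ?mulr1; last by have := hb x xF; rewrite /t; lra.
    by apply: ler_wpM2l (geX _ Xx); rewrite ltW ?vmeas_gt0.
  apply: ler_sum_sub => // [x xF|x].
    by rewrite mem_undup mem_cat xF orbT.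
  have [Xx|/phinX ->] := pselect (X x); last by rewrite mulr0 mul0r.
  rewrite mulr_ge0 //; last exact: le_trans (ltW e0) (geX _ Xx).
  by rewrite mulr_ge0 ?phi0 ?(ltW (vmeas_gt0 _ _)).
rewrite -mulr_suml in S2.
move: Flt; rewrite ltr_pdivrMr //; lra.
Qed.

End Flow.
End Separation.

(** * Compactness and rigidity of extremal functions *)

Lemma pointwise_cluster (R : realType) (V : choiceType) (fs : nat -> V -> R)
    (b : V -> R) : (forall j z, `|fs j z| <= b z) ->
  exists h : V -> R, forall (s : seq V) N (e : R), 0 < e ->
    exists2 j, (N <= j)%N & forall z, z \in s -> `|fs j z - h z| < e.
Proof.
move=> hb.
(* The sequence lives in a product of compact segments and so has a cluster point in the product
   topology. *)
have cA := @tychonoff V (fun=> R) (fun z => `[- b z, b z]%classic)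
  (fun z => @segment_compact R (- b z) (b z)).
have [|h [_ clh]] := cA (fs @ \oo) _.
  by exists 0%N => // j _ z /=; rewrite in_itv /= -ler_norml.
exists h => s N e e0.
pose C := [set fs j | j in [set j | (N <= j)%N]].
have FC : (fs @ \oo) C by exists N => // j Nj; exists j.
pose B := [set g : prod_topology (fun _ : V => R) |
  forall z, z \in s -> `|g z - h z| < e].
have nB : nbhs (h : prod_topology (fun _ : V => R)) B.
  rewrite {}/B; elim: s => [|a s IH]; first by apply: filterS filterT => g _ z.
  have ha : nbhs (h : prod_topology (fun _ : V => R))
      [set g : prod_topology (fun _ : V => R) | `|g a - h a| < e].
    have := @proj_continuous V (fun=> R) a h.
    move=> /(_ [set x | `|x - h a| < e]); apply.
    apply/nbhs_ballP; exists e => // x /=.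
    by rewrite /ball /= distrC.
  apply: filterS (filterI ha IH) => g [ga gs] z.
  by rewrite inE => /predU1P[-> //|]; exact: gs.
have [_ [[j Nj <-] jB]] := clh _ _ FC nB.
by exists j.
Qed.

Section Rigidity.
Variables (R : realType) (V : countType) (G : wgraph R V).
Local Notation d := (d0 G).
Local Notation L := (laplacian G).
Implicit Types (f g : V -> R) (x y z k : V) (K : seq V) (X Y : set V).

Definition connected_seq K := forall k k', k \in K -> k' \in K ->
  exists p, [/\ path (adj G) k p, all (mem K) p & last k p = k'].

Lemma dball_connected x n : connected_seq (dball G x n).
Proof.
have to j z : d x z = j -> (j <= n)%N ->
    exists p, [/\ path (adj G) x p, all (mem (dball G x n)) p & last x p = z].
  elim: j z => [|j IH] z dz jn; first by exists [::]; rewrite (d_eq0 dz).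
  have [y a dy] := d_step_r dz; have [p [h1 h2 h3]] := IH y dy (ltnW jn).
  exists (rcons p z); rewrite rcons_path h1 h3 a all_rcons h2 last_rcons.
  by split => //=; rewrite mem_dball dz jn.
have from j z : d z x = j -> (j <= n)%N ->
    exists p, [/\ path (adj G) z p, all (mem (dball G x n)) p & last z p = x].
  elim: j z => [|j IH] z dz jn; first by exists [::]; rewrite (d_eq0 dz).
  have [y a dy] := d_step dz; have [p [h1 h2 h3]] := IH y dy (ltnW jn).
  exists (y :: p); rewrite /= a h1 h2; split => //=.
  by rewrite mem_dball d_sym dy andbT ltnW.
move=> k k'; rewrite !mem_dball => kn k'n.
rewrite d_sym in kn.
have [p [p1 p2 p3]] := from _ k erefl kn.
have [q [q1 q2 q3]] := to _ k' erefl k'n.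
exists (p ++ q); rewrite cat_path p1 p3 q1 all_cat p2 q2 last_cat p3 q3.
by split.
Qed.

(** Cut the path just before its first visit to [e]. *)
Lemma path_avoid K k e p : path (adj G) k p -> all (mem K) p -> last k p = e ->
  k != e -> exists q, [/\ path (adj G) k q,
    all (mem [seq x <- K | x != e]) q & adj G (last k q) e].
Proof.
elim: p k => [|a p IH] k /=; first by move=> _ _ -> /eqP.
move=> /andP[ka ap] /andP[aK pK] le ke.
have [ae|ane] := eqVneq a e; first by exists [::]; rewrite /= -ae.
have [q [h1 h2 h3]] := IH a ap pK le ane.
exists (a :: q); split => //=; first by rewrite ka.
by rewrite mem_filter ane aK.
Qed.

Lemma separates_move K X Y e : separates G K X Y -> e \in K ->
  (forall y, Y y -> ~~ adj G e y) ->
  separates G [seq x <- K | x != e] (X `|` [set e]) Y.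
Proof.
move=> [cov XK YK XnY XY] eK eY; split.
- move=> z; have [->|ze] := eqVneq z e; first by apply: Or32; right.
  case: (cov z) => [zK|Xz|Yz].
  + by apply: Or31; rewrite mem_filter ze.
  + by apply: Or32; left.
  + exact: Or33.
- move=> x [/XK|->]; rewrite mem_filter; first by move/negbTE ->; rewrite andbF.
  by rewrite eqxx.
- by move=> y /YK; rewrite mem_filter => /negbTE ->; rewrite andbF.
- by move=> z [/XnY //|-> /YK]; rewrite eK.
- by move=> x y [|->]; [exact: XY | exact: eY].
Qed.

Section Curvature.
Hypothesis curv : nonneg_ollivier G.
Variable D : R.
Hypothesis degD : forall x, degree G x <= D.
Hypothesis D_gt0 : 0 < D.

Lemma laplacian_gap K f l k0 : k0 \in K ->
  (forall k, k \in K -> l < L f k) ->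
  exists2 e, l < e & forall k, k \in K -> e <= L f k.
Proof.
move=> k0K lt; have [k kK h] := seq_argmax (fun k => - L f k) k0K.
by exists (L f k); [exact: lt | move=> j /h; rewrite lerN2].
Qed.

Lemma Lip1_laplacian_ge f x : Lip1 G f -> - D <= L f x.
Proof.
move=> lf; apply: le_trans (_ : - (degree G x * 1) <= _).
  by rewrite mulr1 lerN2.
apply: laplacian_ge => y a; have := lf y x; rewrite d_sym (d_adj a); lra.
Qed.

Lemma extremal_shift K X Y f (a : R) : extremal G K X Y f ->
  extremal G K X Y (fun z => f z - a).
Proof.
case=> lf hX hY; split.
- by move=> x y; have := lf x y; lra.
- by move=> x /hX[k kK e]; exists k => //; rewrite -e; ring.
- by move=> y /hY[k kK e]; exists k => //; rewrite -e; ring.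
Qed.

(** Lipschitz bounds pass to cluster points. For the attained extensions take [k] in [K] optimal for
    [h]: it is at least as good as the vertex [k'] that is optimal for a nearby [fs j]. *)
Lemma extremal_closed K X Y (fs : nat -> V -> R) h k0 : k0 \in K ->
  (forall j, extremal G K X Y (fs j)) ->
  (forall (s : seq V) N (e : R), 0 < e ->
    exists2 j, (N <= j)%N & forall z, z \in s -> `|fs j z - h z| < e) ->
  extremal G K X Y h.
Proof.
move=> k0K ext cl.
have approx x y : forall (e : R), 0 < e -> exists2 j, (0 <= j)%N &
    `|fs j x - h x| < e /\ forall k, k \in y :: K -> `|fs j k - h k| < e.
  move=> e e0; have [j j0 hj] := cl [:: x, y & K] 0%N e e0.
  exists j => //; split; first by apply: hj; rewrite mem_head.
  by move=> k kK; apply: hj; rewrite inE kK orbT.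
split.
- move=> x y; apply/ler_addgt0Pr => e e0.
  have [j _ [hx hK]] := approx x y (e / 2) ltac:(lra).
  have hy := hK y (mem_head _ _).
  have [lf _ _] := ext j; have := lf x y.
  move: hx hy; rewrite !ltr_norml; lra.
- move=> x Xx; have [k kK max] := seq_argmax (fun k => h k - (d x k)%:R) k0K.
  exists k => //; apply/eqP; rewrite eq_le; apply/andP; split.
    apply/ler_addgt0Pr => e e0.
    have [j _ [hx hK]] := approx x k (e / 2) ltac:(lra).
    have hy := hK k (mem_head _ _).
    have [lf _ _] := ext j; have := lf x k.
    move: hx hy; rewrite !ltr_norml; lra.
  apply/ler_addgt0Pr => e e0.
  have [j _ [hx hK]] := approx x k (e / 2) ltac:(lra).
  have [_ /(_ x Xx)[k' k'K ek'] _] := ext j.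
  have hk' : `|fs j k' - h k'| < e / 2 by apply: hK; rewrite inE k'K orbT.
  have := max k' k'K.
  by move: hx hk'; rewrite !ltr_norml; lra.
- move=> y Yy.
  have [k kK max] := seq_argmax (fun k => - (h k + (d k y)%:R)) k0K.
  exists k => //; apply/eqP; rewrite eq_le; apply/andP; split.
    apply/ler_addgt0Pr => e e0.
    have [j _ [hx hK]] := approx y k (e / 2) ltac:(lra).
    have hy := hK k (mem_head _ _).
    have [lf _ _] := ext j; have := lf k y.
    move: hx hy; rewrite !ltr_norml; lra.
  apply/ler_addgt0Pr => e e0.
  have [j _ [hx hK]] := approx y k (e / 2) ltac:(lra).
  have [_ _ /(_ y Yy)[k' k'K ek']] := ext j.
  have hk' : `|fs j k' - h k'| < e / 2 by apply: hK; rewrite inE k'K orbT.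
  have := max k' k'K.
  by move: hx hk'; rewrite !ltr_norml; lra.
Qed.

(** The supremum [l] of the uniform lower bounds in [Lam] is attained by compactness, at some [h].
    If [L h > l] somewhere on [K], spreading would beat [l]. The flux on [X] gives [l <= 0], and the
    flux of [- h] on [Y] gives [l >= 0]. *)
Lemma extremal_harmonic_exists K X Y k0 : separates G K X Y -> k0 \in K ->
  connected_seq K -> infinite_mass G X -> infinite_mass G Y ->
  exists2 f, extremal G K X Y f & forall k, k \in K -> L f k = 0.
Proof.
move=> sep k0K conn mX mY.
pose Lam : set R := [set l | exists2 f, extremal G K X Y f &
  forall k, k \in K -> l <= L f k].
have Lam_le0 l : Lam l -> l <= 0.
  move=> [f ext h]; rewrite leNgt; apply/negP => l0.
  exact: (extremal_flux curv sep mX ext l0 h).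
have Lam0 : Lam !=set0.
  have [|f ext _] := @extremal_exists _ _ G K X Y (fun=> 0) k0 sep k0K.
    by move=> x y; rewrite subrr ler0n.
  exists (- D), f => // k _; apply: Lip1_laplacian_ge.
  by case: ext.
have hs : has_sup Lam by split => //; exists 0 => l /Lam_le0.
pose l := sup Lam.
have [f0 hf0] : {f0 : nat -> V -> R & forall j, extremal G K X Y (f0 j) /\
    forall k, k \in K -> l - j.+1%:R^-1 <= L (f0 j) k}.
  apply: (@choice _ _ (fun j f => extremal G K X Y f /\
    forall k, k \in K -> l - j.+1%:R^-1 <= L f k)) => j.
  have [|e [f ext h] lt] := @sup_adherent R Lam j.+1%:R^-1 _ hs.
    by rewrite invr_gt0.
  exists f; split => // k kK; apply: le_trans (h k kK).
  exact: ltW.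
(* Normalising at [k0] bounds the sequence by the distance to [k0] and leaves the Laplacians
   unchanged. *)
pose fs j z := f0 j z - f0 j k0.
have ext j : extremal G K X Y (fs j).
  exact: (extremal_shift (f0 j k0) (hf0 j).1).
have Lfs j k : L (fs j) k = L (f0 j) k.
  by rewrite /fs laplacianB laplacian_cst subr0.
have [|h hh] := @pointwise_cluster R V fs (fun z => (d k0 z)%:R).
  by move=> j z; have [[lf _ _] _] := hf0 j; exact: Lip1_abs.
have exth := extremal_closed k0K ext hh.
have Lh k : k \in K -> l <= L h k.
  move=> kK; suff le (e : R) : 0 < e -> l <= L h k + e by apply/ler_addgt0Pr.
  (* One half of [e] absorbs the defect [q] of the maximising sequence, the other the error
     [D * (2 * e')] of the Laplacian. *)
  move=> e0; pose e' : R := e / (4 * D).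
  have e'0 : 0 < e' by rewrite divr_gt0 // mulr_gt0.
  have [j Nj hj] := hh (k :: nbrs G k) (Num.trunc (2 / e)) e' e'0.
  pose q : R := j.+1%:R^-1.
  have : l - q <= L (fs j) k by rewrite Lfs; exact: (hf0 j).2.
  have : - (degree G k * (2 * e')) <= L (fun z => h z - fs j z) k.
    apply: laplacian_ge => y; rewrite -mem_nbrs => a.
    have := hj k (mem_head _ _).
    have : `|fs j y - h y| < e' by apply: hj; rewrite inE a orbT.
    by rewrite !ltr_norml; lra.
  have : degree G k * (2 * e') <= D * (2 * e') by rewrite ler_wpM2r //; lra.
  have -> : D * (2 * e') = e / 2 by rewrite /e'; field; rewrite gt_eqF.
  have : q <= e / 2.
    rewrite /q -[e / 2]invrK lef_pV2 ?posrE ?invr_gt0 ?divr_gt0 //.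
    rewrite invf_div; apply: ltW; apply: lt_le_trans (truncnS_gt _) _.
    by rewrite ler_nat.
  by rewrite (laplacianB G h (fs j)); lra.
have Lh_eq k : k \in K -> L h k = l.
  move=> kK; apply/eqP; rewrite eq_le Lh // andbT leNgt; apply/negP => lt.
  have [|f' ext' gt'] := extremal_spread curv degD D_gt0 sep k0K exth Lh.
    move=> k' k'K; have [p [h1 h2 h3]] := conn k' k k'K kK.
    by exists p; rewrite h3.
  have [e le he] := laplacian_gap k0K gt'.
  have : e <= l by apply: ub_le_sup => //; [exact: hs.2 | exists f'].
  by rewrite leNgt le.
exists h => // k kK; rewrite Lh_eq //; apply/eqP; rewrite eq_le.
apply/andP; split; first by apply: Lam_le0; exists h.
rewrite leNgt; apply/negP => l0.
have l0' : 0 < - l by rewrite oppr_gt0.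
apply: (extremal_flux curv (separates_sym sep) mY (extremalN exth) l0').
by move=> j jK; rewrite laplacianN Lh_eq.
Qed.

(** Pass [e] to the side of [X] and re-extend [f] from the rest of [K], which gives [f0 <= f]. If
    [f0 e = f e], steepness at [e] provides [y]. Otherwise [- f0] has non-negative Laplacian on
    [K0], positive next to [e], and spreading contradicts the flux bound on [Y]. *)
Lemma extremal_up K X Y f e k0 : separates G K X Y -> connected_seq K ->
  infinite_mass G Y -> extremal G K X Y f ->
  (forall k, k \in K -> L f k = 0) -> e \in K ->
  (forall y, Y y -> ~~ adj G e y) -> k0 \in K -> k0 != e ->
  exists2 y, adj G e y & f y = f e + 1.
Proof.
move=> sep conn mY ext Lf0 eK eY k0K k0e.
have [lf fX fY] := ext.
have sep0 := separates_move sep eK eY.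
set K0 := [seq x <- K | x != e] in sep0; set X0 := X `|` [set e] in sep0.
have k0K0 : k0 \in K0 by rewrite mem_filter k0e.
have [f0 ext0 f0K] := extremal_exists sep0 k0K0 lf.
have [lf0 f0X f0Y] := ext0.
have f0_le z : f0 z <= f z.
  have [cov _ _ _ _] := sep0.
  case: (cov z) => [/f0K -> //|/f0X[k kK h]|Yz].
    by have := lf z k; rewrite -h (f0K k) //; lra.
  have [k kK h] := fY z Yz.
  have [ke|ke] := eqVneq k e; last first.
    have kK0 : k \in K0 by rewrite mem_filter ke.
    by have := lf0 k z; rewrite (f0K k) //; lra.
  (* When [f z] is realised from [e] itself, a geodesic from [z] to [e] meets [K0] at some [j],
     where [f0] and [f] agree. *)
  have nYe : ~ Y e by case: sep => _ _ YK _ _ /YK; rewrite eK.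
  have [j jK0 hj] := separates_exit (separates_sym sep0) Yz nYe.
  have := lf0 j z; rewrite (f0K j) // => h1; have h2 := lf e j.
  rewrite ke d_sym hj natrD in h.
  rewrite (d_sym G j z) in h1; rewrite (d_sym G e j) in h2.
  lra.
have [k kK0 hk] : exists2 k, k \in K0 & f0 k - f0 e = (d e k)%:R.
  by apply: f0X; right.
have [ee|ne] := eqVneq (f0 e) (f e).
  rewrite ee f0K // in hk.
  have ke : k != e by move: kK0; rewrite mem_filter => /andP[].
  case E : (d e k) => [|n]; first by rewrite (d_eq0 E) eqxx in ke.
  have [y [a h _]] := Lip1_steep_step lf E hk.
  by exists y => //; lra.
exfalso.
have lt_e : 0 < f e - f0 e.
  by rewrite subr_gt0 lt_neqAle ne f0_le.
have Lu k' : k' \in K0 -> L f0 k' = - L (fun z => f z - f0 z) k'.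
  move=> k'K0; rewrite laplacianB Lf0 ?sub0r ?opprK //.
  by move: k'K0; rewrite mem_filter => /andP[].
have uk' k' : k' \in K0 -> f k' - f0 k' = 0.
  by move=> k'K0; rewrite f0K // subrr.
have extN := extremalN ext0.
have [|k' k'K0|f' ext' gt'] :=
  @extremal_spread _ _ _ curv D degD D_gt0 K0 Y X0 _ 0 k0
    (separates_sym sep0) k0K0 extN.
- move=> k' k'K0; rewrite laplacianN Lu // opprK; apply: laplacian_ge0 => y _.
  by rewrite uk' // subr_ge0.
- have [k'e k'K] : k' != e /\ k' \in K.
    by move: k'K0; rewrite mem_filter => /andP[].
  have [p [h1 h2 h3]] := conn k' e k'K eK.
  have [q [q1 q2 q3]] := path_avoid h1 h2 h3 k'e.
  exists q; split => //.
  have lK0 : last k' q \in K0.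
    case: q {q1 q3} q2 => //= a q /andP[aK qK].
    elim: q a aK qK => //= b q IH a aK /andP[bK qK]; exact: IH.
  rewrite laplacianN Lu // opprK; apply: (@laplacian_gt0 _ _ _ _ _ e) => //.
    by move=> y _; rewrite uk' // subr_ge0.
  by rewrite uk'.
have [b b0 hb] := laplacian_gap k0K0 gt'.
exact: (extremal_flux curv (separates_sym sep0) mY ext' b0 hb).
Qed.

End Curvature.
End Rigidity.

(** * Layers of the height function *)

Section Layers.
Variables (R : realType) (V : countType) (G : wgraph R V).
Local Notation w := (weight G).
Local Notation m := (vmeas G).
Local Notation d := (d0 G).
Local Notation L := (laplacian G).
Implicit Types (f g : V -> R) (x y z k : V) (K A : seq V) (X Y : set V).

Hypothesis curv : nonneg_ollivier G.
Variable D : R.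
Hypothesis degD : forall x, degree G x <= D.
Hypothesis D_gt0 : 0 < D.
Variable c : R.
Hypothesis c_gt0 : 0 < c.
Hypothesis weight_ge : forall x y, adj G x y -> c <= w x y.

Lemma extremal_down K X Y f e k0 : separates G K X Y -> connected_seq G K ->
  infinite_mass G X -> extremal G K X Y f ->
  (forall k, k \in K -> L f k = 0) -> e \in K ->
  (forall y, X y -> ~~ adj G e y) -> k0 \in K -> k0 != e ->
  exists2 y, adj G e y & f y = f e - 1.
Proof.
move=> sep conn mX ext Lf0 eK eX k0K k0e.
have [|y a h] := extremal_up curv degD D_gt0 (separates_sym sep) conn mX
  (extremalN ext) _ eK eX k0K k0e.
  by move=> k kK; rewrite laplacianN Lf0 // oppr0.
by exists y => //; lra.
Qed.

Definition steep_at f z :=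
  (exists2 y, adj G z y & f y = f z + 1) /\
  (exists2 y, adj G z y & f y = f z - 1).

(* Green's formula with [clamp t f] minus the indicator of the complement of
   [X0], which has finite support: each vertex of the layer carries at least
   [c] of energy, whereas the flux of [f] through [K0] is at most the boundary
   weight of [K0]. *)
Lemma layer_bound K0 X0 Y0 K X Y f t A :
  separates G K0 X0 Y0 -> separates G K X Y ->
  (forall x, X x -> X0 x) -> (forall y, Y y -> Y0 y) ->
  extremal G K X Y f -> (forall k, k \in K -> L f k = 0) ->
  uniq A -> (forall z, z \in A -> t <= f z <= t + 1 /\ steep_at f z) ->
  (size A)%:R * c <= 2 * boundary_weight G K0.
Proof.
move=> sep0 sep XX0 YY0 ext Lf0 uA hA.
have [cov0 X0K Y0K XnY0 XY0] := sep0; have [cov XK YK XnY XY] := sep.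
have [lf fX fY] := ext.
pose chi x : R := if `[< X0 x >] then 0 else 1.
have chi0 x : X0 x -> chi x = 0 by move=> h; rewrite /chi asboolT.
have chi1 x : ~ X0 x -> chi x = 1 by move=> h; rewrite /chi asboolF.
pose tau x := clamp t (f x).
pose phi x := tau x - chi x.
have phiX x : X x -> phi x = tau x by move=> /XX0 h; rewrite /phi chi0 ?subr0.
have phiY y : Y y -> phi y = tau y - 1.
  by move=> /YY0 Yy; rewrite /phi chi1 // => Xy; exact: (XnY0 y).
have [n1 h1] := extremal_fin t ext.
have [n2 h2] := extremal_fin (- (t + 1)) (extremalN ext).
pose n := maxn n1 n2.
have nmax z k : z \in dball G k n1 \/ z \in dball G k n2 -> z \in dball G k n.
  by case; apply: sub_dball; rewrite leq_max leqnn ?orbT.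
pose W := undup (flatten [seq dball G k n.+1 | k <- K] ++
  A ++ flatten [seq nbrs G a | a <- A]).
have uW : uniq W by exact: undup_uniq.
have KW k z : k \in K -> z \in dball G k n.+1 -> z \in W.
  move=> kK zk; rewrite mem_undup mem_cat; apply/orP; left.
  by apply/flattenP; exists (dball G k n.+1) => //; apply/mapP; exists k.
have AW z : z \in A -> z \in W.
  by move=> zA; rewrite mem_undup !mem_cat zA orbT.
have AnW z y : z \in A -> adj G z y -> y \in W.
  move=> zA a; rewrite mem_undup !mem_cat; apply/orP; right.
  apply/orP; right; apply/flattenP; exists (nbrs G z); last by rewrite mem_nbrs.
  by apply/mapP; exists z.
have supp x : x \in W -> phi x != 0 -> {subset nbrs G x <= W}.
  move=> _ px y; rewrite mem_nbrs => a.
  suff [k kK xk] : exists2 k, k \in K & x \in dball G k n.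
    by apply: KW kK _; apply: dball_nbr a.
  case: (cov x) => [xK|Xx|Yx].
  - by exists x => //; exact: dball_center.
  - have [|k kK xk] := h1 x Xx; last by exists k => //; apply: nmax; left.
    rewrite ltNge; apply: contraNN px => /clamp0.
    by rewrite phiX // /tau => ->.
  - have [|k kK xk] := h2 x Yx; last by exists k => //; apply: nmax; right.
    rewrite ltrN2 ltNge; apply: contraNN px => /clamp1.
    by rewrite phiY // /tau => ->; rewrite subrr.
have E := sum_by_parts f uW supp.
(* [phi] and [L f] are both non-negative on [X] and both non-positive on [Y], and [L f] vanishes on
   [K]. *)
have pos : 0 <= \sum_(x <- W) m x * phi x * L f x.
  apply: sumr_ge0 => x _; rewrite -mulrA mulr_ge0 ?(ltW (vmeas_gt0 _ _)) //.
  case: (cov x) => [xK|Xx|Yx]; first by rewrite Lf0 ?mulr0.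
    rewrite phiX // /tau mulr_ge0 ?clamp_ge0 //.
    have [k kK h] := fX x Xx;
    by rewrite -(Lf0 k kK); exact: (laplacian_steep curv lf h).
  rewrite phiY // /tau mulr_le0 ?subr_le0 ?clamp_le1 //.
  have [k kK h] := fY x Yx;
  by rewrite -(Lf0 k kK); exact: (laplacian_steep curv lf h).
pose S1 := \sum_(x <- W) \sum_(y <- W) w x y * (f y - f x) * (tau y - tau x).
pose S2 := \sum_(x <- W) \sum_(y <- W) w x y * (f y - f x) * (chi y - chi x).
have ES : \sum_(x <- W) \sum_(y <- W) w x y * (f y - f x) * (phi y - phi x)
    = S1 - S2.
  rewrite /S1 /S2 -sumrB; apply: eq_bigr => x _; rewrite -sumrB.
  by apply: eq_bigr => y _; rewrite /phi; ring.
have S2_le : S2 <= 2 * boundary_weight G K0.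
  apply: le_trans (boundary_sum_le G K0 uW).
  apply: ler_sum => x _; apply: ler_sum => y _.
  have [a|/weight_nadj ->] := boolP (adj G x y); last by rewrite !mul0r.
  rewrite -mulrA; apply: ler_wpM2l; first exact: weight_ge0.
  have l1 := lf x y; have l2 := lf y x.
  rewrite (d_adj a) in l1; rewrite d_sym (d_adj a) in l2.
  have b1 : 0 <= (x \in K0)%:R :> R by rewrite ler0n.
  have b2 : 0 <= (y \in K0)%:R :> R by rewrite ler0n.
  have [Xx|nXx] := pselect (X0 x); have [Xy|nXy] := pselect (X0 y).
  - by rewrite !chi0 // subrr mulr0 addr_ge0.
  - rewrite (chi0 x) // (chi1 y) // subr0 mulr1.
    have yK : y \in K0.
      by case: (cov0 y) => // Yy; have := XY0 _ _ Xx Yy; rewrite a.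
    rewrite yK; have -> : true%:R = 1 :> R by [].
    by lra.
  - rewrite (chi1 x) // (chi0 y) // sub0r mulrN1.
    have xK : x \in K0.
      case: (cov0 x) => // Yx; have := XY0 _ _ Xy Yx.
      by rewrite adj_sym a.
    rewrite xK; have -> : true%:R = 1 :> R by [].
    by lra.
  - by rewrite !chi1 // subrr mulr0 addr_ge0.
have S1_ge : (size A)%:R * c <= S1.
  have t0 x y : 0 <= w x y * (f y - f x) * (tau y - tau x).
    by rewrite -mulrA mulr_ge0 ?weight_ge0 // clamp_prod_ge0.
  apply: le_trans (_ : \sum_(x <- A) \sum_(y <- W)
     w x y * (f y - f x) * (tau y - tau x) <= _); last first.
    by apply: ler_sum_sub => // x; rewrite sumr_ge0.
  have -> : (size A)%:R * c = \sum_(x <- A) c.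
    by rewrite big_const_seq count_predT iter_addr_0 mulr_natl.
  rewrite big_seq [leRHS]big_seq; apply: ler_sum => x xA.
  have [/andP[tf ft] [[y1 a1 e1] [y2 a2 e2]]] := hA x xA.
  apply: le_trans (_ : \sum_(y <- [:: y1; y2])
     w x y * (f y - f x) * (tau y - tau x) <= _); last first.
    apply: ler_sum_sub => // [|y].
      by rewrite /= inE andbT; apply/eqP => e; move: e1; rewrite e e2; lra.
    by rewrite !inE => /orP[] /eqP ->; apply: AnW xA _.
  (* The edges to [y1] and [y2] contribute their weights times [1 - (f x - t)] and [f x - t], two
     fractions that add up to 1. *)
  rewrite big_cons big_seq1 /tau (clamp_mid tf ft) clamp1; last by lra.
  rewrite clamp0; last by lra.
  rewrite e1 e2.
  have : 0 <= (w x y1 - c) * (1 - (f x - t)).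
    by rewrite mulr_ge0 ?subr_ge0 ?weight_ge //; lra.
  have : 0 <= (w x y2 - c) * (f x - t).
    by rewrite mulr_ge0 ?subr_ge0 ?weight_ge //; lra.
  by lra.
by rewrite ES in E; lra.
Qed.

Hypothesis sal : salami G.

(** Both sides of the partition contain a vertex, so [z] is not alone in a connected graph. This
    gives the edge at [z] through which bounded geometry controls measure and degree, and the second
    separator vertex that [extremal_up] asks for. *)
Lemma exists_adj z : exists y, adj G z y.
Proof.
have [_ [X [Y [K [_ [XY _ _] _ _ [mX' mY']]]]]] := sal.
have mX := infinite_massP mX'; have mY := infinite_massP mY'.
have [[|a F] [_ FX]] := mX 0; first by rewrite big_nil ltxx.
have [[|b F'] [_ FY]] := mY 0; first by rewrite big_nil ltxx.
move=> _ _; have Xa := FX a (mem_head _ _); have Yb := FY b (mem_head _ _).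
have ab : a != b.
  apply/eqP => ab; have : (X `&` Y) a by split => //; rewrite ab.
  by rewrite XY.
have [x xz] : exists x, x != z.
  have [az|] := eqVneq a z; last by exists a.
  by exists b; rewrite -az eq_sym.
case E : (d z x) => [|n].
  by rewrite (d_eq0 E) eqxx in xz.
by have [y a' _] := d_step E; exists y.
Qed.

(** The separator is enlarged to a ball around [x0], so [f] varies with [x0] and [n]; [N] does not,
    because [layer_bound] measures the flux through the original separator. *)
Lemma salami_height : exists N : nat, forall x0 n, exists f,
  [/\ Lip1 G f,
      forall z, z \in dball G x0 n -> L f z = 0 /\ steep_at f z
    & forall (t : R) A, uniq A -> {subset A <= dball G x0 n} ->
      (forall z, z \in A -> t <= f z <= t + 1) -> (size A <= N)%N].
Proof.
have [_ [X0 [Y0 [K0' [cov [XY XK YK] finK eXY [mX mY]]]]]] := sal.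
pose K0 : seq V := fset_set K0'.
have inK0 z : (z \in K0) <-> K0' z by rewrite in_fset_set // inE.
have dis (P Q : set V) z : P `&` Q = set0 -> P z -> ~ Q z.
  by move=> PQ Pz Qz; have : (P `&` Q) z by []; rewrite PQ.
have sep0 : separates G K0 X0 Y0.
  split.
  - move=> z; have : setT z by []; rewrite -cov => -[[Xz|Yz]|/inK0 Kz].
    + exact: Or32.
    + exact: Or33.
    + exact: Or31.
  - by move=> x Xx; apply/negP => /inK0; exact: dis XK Xx.
  - by move=> x Xx; apply/negP => /inK0; exact: dis YK Xx.
  - by move=> z; exact: dis XY.
  - move=> x y Xx Yy; apply/negP => a.
    have : edges G X0 Y0 (x, y) by [].
    by rewrite eXY.
exists (Num.trunc (2 * boundary_weight G K0 / c)) => x0 n.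
have [M hM] := @seq_bound V K0 (fun k j => d x0 k = j)
  (fun k _ => ex_intro _ (d x0 k) erefl).
(* Radius [n.+1] puts all neighbours of the ball of radius [n] into [K], so that this ball touches
   neither side; [M] brings in [K0]. *)
pose r := maxn n.+1 M; pose K := dball G x0 r.
have K0K : {subset K0 <= K}.
  move=> k /hM[j jM dj]; rewrite mem_dball dj.
  by rewrite (leq_trans jM) // leq_maxr.
have nK z y : z \in dball G x0 n -> adj G z y -> y \in K.
  move=> zn a; apply: sub_dball (dball_nbr zn a).
  exact: leq_maxl.
pose X := X0 `\` [set` K]; pose Y := Y0 `\` [set` K].
have sep : separates G K X Y.
  have [c1 c2 c3 c4 c5] := sep0; split.
  - move=> z; have [zK|/negP zK] := boolP (z \in K); first exact: Or31.
    case: (c1 z) => [/K0K //|Xz|Yz]; [exact: Or32 | exact: Or33].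
  - by move=> x [_ /negP].
  - by move=> x [_ /negP].
  - by move=> z [/c4 + _] [].
  - by move=> x y [Xx _] [Yy _]; exact: c5.
have mX' : infinite_mass G X by apply/infinite_massD/infinite_massP.
have mY' : infinite_mass G Y by apply/infinite_massD/infinite_massP.
have conn : connected_seq G K by exact: dball_connected.
have x0K : x0 \in K by exact: dball_center.
have [f ext Lf0] :=
  extremal_harmonic_exists curv degD D_gt0 sep x0K conn mX' mY'.
have steep z : z \in dball G x0 n -> steep_at f z.
  move=> zn; have zK : z \in K.
    by apply: sub_dball zn; rewrite leq_max leqnSn.
  have [y a] := exists_adj z; have yz : y != z by rewrite eq_sym (adj_irr a).
  have yK := nK _ _ zn a.
  split.
    apply: (extremal_up curv degD D_gt0 sep conn mY' ext Lf0 zK _ yK yz).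
    by move=> y' [_ /negP yK']; apply: contraNN yK'; exact: nK.
  apply: (extremal_down sep conn mX' ext Lf0 zK _ yK yz).
  by move=> y' [_ /negP yK']; apply: contraNN yK'; exact: nK.
have [lf _ _] := ext.
exists f; split => // [z zn|t A uA sA hA].
  split; last exact: steep.
  by apply: Lf0; apply: sub_dball zn; rewrite leq_max leqnSn.
have : (size A)%:R * c <= 2 * boundary_weight G K0.
  apply: (layer_bound sep0 sep _ _ ext Lf0 uA).
  - by move=> x [].
  - by move=> y [].
  - by move=> z zA; split; [exact: hA | apply: steep; exact: sA].
rewrite -ler_pdivlMr // => h.
rewrite -ltnS -(ltr_nat R); apply: le_lt_trans h (truncnS_gt _).
Qed.

End Layers.

(** * Harnack inequality *)

Section Harnack.
Variables (R : realType) (V : countType) (G : wgraph R V).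
Local Notation w := (weight G).
Local Notation m := (vmeas G).
Local Notation d := (d0 G).
Local Notation L := (laplacian G).
Implicit Types (v : V -> R) (x y z : V).

Variables c B : R.
Hypothesis c_gt0 : 0 < c.
Hypothesis weight_ge : forall x y, adj G x y -> c <= w x y.
Hypothesis B_ge0 : 0 <= B.
Hypothesis flow_le : forall x, m x * degree G x <= B.
Variable N : nat.
Hypothesis growth : forall x n, (size (dball G x n) <= N * (2 * n).+1)%N.

(** With [p = v y / v x] this is [(p - 1) ^+ 2 / p], a symmetric substitute for the squared
    difference of logarithms. *)
Definition rel_energy v x y := (v y - v x) ^+ 2 / (v x * v y).

(* The test function is [eta ^+ 2 / v], with a cutoff [eta] which is linear
   between the radii [r] and [2 * r]. *)
Lemma log_caccioppoli x0 (r : nat) v : (0 < r)%N ->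
  (forall z, z \in dball G x0 (2 * r) -> 0 < v z) ->
  (forall z, (d x0 z < 2 * r)%N -> L v z = 0) ->
  \sum_(x <- dball G x0 (2 * r)) \sum_(y <- dball G x0 (2 * r))
    w x y * ((x \in dball G x0 r) && (y \in dball G x0 r))%:R * rel_energy v x y
  <= 5 * N%:R * B / r%:R.
Proof.
move=> r0 vpos harm; set W := dball G x0 (2 * r).
have r0' : 0 < r%:R :> R by rewrite ltr0n.
have uW : uniq W by exact: dball_uniq.
pose eta z := clamp 0 (2 - (d x0 z)%:R / r%:R : R).
have eta1 z : z \in dball G x0 r -> eta z = 1.
  rewrite mem_dball => h; apply: clamp1; rewrite add0r.
  suff : (d x0 z)%:R / r%:R <= 1 :> R by lra.
  by rewrite ler_pdivrMr // mul1r ler_nat.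
have eta0 z : (2 * r <= d x0 z)%N -> eta z = 0.
  move=> h; apply: clamp0; suff : 2 <= (d x0 z)%:R / r%:R :> R by lra.
  by rewrite ler_pdivlMr // -natrM ler_nat.
pose psi z := eta z ^+ 2 / v z.
have lt_d z : psi z != 0 -> (d x0 z < 2 * r)%N.
  rewrite ltnNge; apply: contraNN => /eta0; rewrite /psi => ->.
  by rewrite expr0n mul0r.
have supp x : x \in W -> psi x != 0 -> {subset nbrs G x <= W}.
  move=> _ /lt_d xd y; rewrite mem_nbrs => a; rewrite mem_dball.
  have := d_triangle G x x0 y; rewrite (d_adj a); lia.
have := sum_by_parts v uW supp.
have -> : \sum_(x <- W) m x * psi x * L v x = 0.
  apply: big1 => x _; have [->|/lt_d h] := eqVneq (psi x) 0.
    by rewrite mulr0 mul0r.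
  by rewrite harm // mulr0.
rewrite mulr0 oppr0 => E.
set S := \sum_(x <- W) _.
suff : S <= \sum_(x <- W) \sum_(y <- W) w x y * r%:R^-2.
  move=> h; apply: le_trans h _.
  apply: le_trans (_ : \sum_(x <- W) B * r%:R^-2 <= _).
    apply: ler_sum => x _; rewrite -mulr_suml ler_wpM2r ?invr_ge0 ?sqr_ge0 //.
    exact: le_trans (sum_weight_le G x uW) (flow_le x).
  rewrite big_const_seq count_predT iter_addr_0 -[_ *+ size W]mulr_natr.
  have -> : 5 * N%:R * B / r%:R = B * r%:R^-2 * (5 * N%:R * r%:R).
    by field; rewrite gt_eqF.
  apply: ler_wpM2l; first by rewrite mulr_ge0 ?invr_ge0 ?sqr_ge0.
  (* Linear growth: at most [N * (4 * r + 1) <= 5 * N * r] vertices, as [r] is positive. *)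
  rewrite -!natrM ler_nat; apply: leq_trans (growth _ _) _.
  rewrite -mulnA mulnCA leq_mul2l; apply/orP; right; lia.
set S' := \sum_(x <- W) _ in E.
suff : S + S' <= \sum_(x <- W) \sum_(y <- W) w x y * r%:R^-2.
  by rewrite E addr0.
rewrite /S /S' -big_split /= big_seq [leRHS]big_seq.
apply: ler_sum => x xW; rewrite -big_split /= big_seq [leRHS]big_seq.
apply: ler_sum => y yW.
have [a|/weight_nadj ->] := boolP (adj G x y); last by rewrite !mul0r addr0.
rewrite -!mulrA -mulrDr; apply: ler_wpM2l; first exact: weight_ge0.
have vx := vpos x xW; have vy := vpos y yW.
have ri : 0 <= r%:R^-2 :> R by rewrite invr_ge0 sqr_ge0.
(* On edges inside the smaller ball [eta = 1], and the test term is exactly minus the relative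
   energy. *)
case: (boolP (_ && _)) => [/andP[/eta1 xr /eta1 yr]|_].
  apply: le_trans ri; rewrite /psi xr yr /rel_energy.
  have -> : true%:R * ((v y - v x) ^+ 2 / (v x * v y)) +
    (v y - v x) * (1 ^+ 2 / v y - 1 ^+ 2 / v x) = 0 => //.
  by rewrite mul1r; field; rewrite !gt_eqF.
rewrite mul0r add0r; apply: le_trans (log_energy_le _ _ vx vy) _.
apply: le_trans (clamp_lip _ _ _) _.
have -> : (2 - (d x0 y)%:R / r%:R - (2 - (d x0 x)%:R / r%:R)) ^+ 2
   = ((d x0 x)%:R - (d x0 y)%:R) ^+ 2 * r%:R^-2 :> R.
  by field; rewrite gt_eqF.
rewrite -[leRHS]mul1r ler_wpM2r //.
have := d_triangle G x x0 y; have := d_triangle G y x0 x.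
rewrite (d_sym G y x) (d_adj a) -!(ler_nat R) !natrD => h1 h2.
set t := (_ - _ in leLHS); rewrite -subr_ge0.
have -> : 1 - t ^+ 2 = (1 - t) * (1 + t) by ring.
by rewrite mulr_ge0 // /t; lra.
Qed.

Lemma rel_energy_sym v x y : rel_energy v x y = rel_energy v y x.
Proof.
by rewrite /rel_energy (mulrC (v x)); congr (_ / _); ring.
Qed.

Lemma rel_energy_ge0 v x y : 0 <= v x -> 0 <= v y -> 0 <= rel_energy v x y.
Proof. by move=> h1 h2; rewrite divr_ge0 ?sqr_ge0 ?mulr_ge0. Qed.

(** Chain [ratio_le_expR] with [t = r^-1] along a geodesic from [x0]. Its at most [r] edges
    contribute at most 1 through [t], and the total energy is of order [1 / r], which cancels the
    factor [r] in front of it. *)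
Lemma harnack : exists2 H : R, 1 <= H &
  forall x0 (r : nat) (v : V -> R), (0 < r)%N ->
  (forall z, z \in dball G x0 (2 * r) -> 0 < v z) ->
  (forall z, (d x0 z < 2 * r)%N -> L v z = 0) ->
  forall z, z \in dball G x0 r -> v z <= H * v x0 /\ v x0 <= H * v z.
Proof.
exists (expR (1 + 5 * N%:R * B / c)).
  have : 0 <= 5 * N%:R * B / c 
    by rewrite divr_ge0 ?mulr_ge0 ?ler0n ?(ltW c_gt0).
  by have := expR_ge1Dx (1 + 5 * N%:R * B / c); lra.
move=> x0 r v r0 vpos harm z zr.
have r0' : 0 < r%:R :> R by rewrite ltr0n.
pose W := dball G x0 (2 * r).
pose T x := \sum_(y <- W)
  w x y * ((x \in dball G x0 r) && (y \in dball G x0 r))%:R * rel_energy v x y.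
have le_W y : y \in dball G x0 r -> y \in W.
  by apply: sub_dball; rewrite leq_pmull.
have term_ge0 x y : x \in W -> y \in W ->
    0 <= w x y * ((x \in dball G x0 r) && (y \in dball G x0 r))%:R
      * rel_energy v x y.
  move=> xW yW; apply: mulr_ge0; first by rewrite mulr_ge0 ?weight_ge0.
  by apply: rel_energy_ge0; apply/ltW/vpos.
have T0 x : x \in W -> 0 <= T x.
  move=> xW; rewrite /T big_seq sumr_ge0 // => y yW.
  exact: term_ge0.
have T_ge x y : x \in dball G x0 r -> y \in dball G x0 r -> adj G x y ->
    c * rel_energy v x y <= T x.
  move=> xr yr a; have vx := vpos x (le_W x xr); have vy := vpos y (le_W y yr).
  rewrite /T (bigD1_seq y) ?dball_uniq ?le_W //= xr yr mulr1.
  apply: ler_wpDr; last first.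
    by rewrite ler_wpM2r ?weight_ge // rel_energy_ge0 // ltW.
  rewrite big_seq_cond sumr_ge0 // => y' /andP[yW' _].
  by have := term_ge0 x y' (le_W x xr) yW'; rewrite xr.
(* The exponent spent up to distance [j]: each edge of the geodesic is charged to the energy [T] at
   its end nearer to [x0]. *)
pose E j := j%:R / r%:R + r%:R / c * \sum_(x <- W | (d x0 x < j)%N) T x.
have E_step j y : y \in dball G x0 r -> d x0 y = j ->
    E j + (r%:R^-1 + r%:R / c * T y) <= E j.+1.
  move=> yr dy; rewrite /E -natr1.
  have : \sum_(x <- W | (d x0 x < j)%N) T x + T y
      <= \sum_(x <- W | (d x0 x < j.+1)%N) T x.
    rewrite big_mkcond [leRHS]big_mkcond /=.
    rewrite (bigD1_seq y) ?dball_uniq ?le_W //= dy ltnn add0r addrC.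
    rewrite [leRHS](bigD1_seq y) ?dball_uniq ?le_W //= dy ltnSn lerD2l.
    rewrite big_seq_cond [leRHS]big_seq_cond; apply: ler_sum => x /andP[xW _].
    by case: ltnP => [/ltnW|_]; [rewrite ltnS => -> | case: ifP; rewrite ?T0].
  move=> h; have : r%:R / c * (\sum_(x <- W | (d x0 x < j)%N) T x + T y)
      <= r%:R / c * \sum_(x <- W | (d x0 x < j.+1)%N) T x.
    by rewrite ler_wpM2l // divr_ge0 // ltW.
  by rewrite mulrDr mulrDl mul1r; lra.
have step (y' y : V) (b : R) : y \in dball G x0 r -> y' \in dball G x0 r ->
    rel_energy v y' y * c <= b -> v y <= v y' * expR (r%:R^-1 + r%:R / c * b).
  move=> yr y'r le; have vy := vpos y (le_W y yr); have vy' := vpos y' (le_W y' y'r).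
  have ri : 0 < r%:R^-1 :> R by rewrite invr_gt0.
  apply: le_trans (ratio_le_expR vy' vy ri) _.
  rewrite ler_wpM2l ?(ltW vy') // ler_expR lerD2l invrK mulrC -mulrA.
  by rewrite ler_wpM2l ?(ltW r0') // [leRHS]mulrC ler_pdivlMr.
have key j y : d x0 y = j -> (j <= r)%N ->
    v y <= v x0 * expR (E j) /\ v x0 <= v y * expR (E j).
  elim: j y => [|j IH] y dy jr.
    by rewrite -(d_eq0 dy) /E mul0r add0r big_pred0 // mulr0 expR0 mulr1.
  have [y' a dy'] := d_step_r dy; have [h1 h2] := IH y' dy' (ltnW jr).
  have y'r : y' \in dball G x0 r by rewrite mem_dball dy' ltnW.
  have yr : y \in dball G x0 r by rewrite mem_dball dy.
  have le : rel_energy v y' y * c <= T y' by rewrite mulrC T_ge.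
  have vy := vpos y (le_W y yr); have vy' := vpos y' (le_W y' y'r).
  have vx := vpos x0 (le_W x0 (dball_center _ _ _)).
  have Ele := E_step j y' y'r dy'.
  split.
    apply: le_trans (step y' y _ yr y'r le) _.
    apply: le_trans (ler_wpM2r (expR_ge0 _) h1) _.
    by rewrite -[leLHS]mulrA -expRD ler_wpM2l ?(ltW vx) // ler_expR.
  apply: le_trans h2 _; rewrite rel_energy_sym in le.
  apply: le_trans (ler_wpM2r (expR_ge0 _) (step y y' _ y'r yr le)) _.
  by rewrite -[leLHS]mulrA -expRD ler_wpM2l ?(ltW vy) // ler_expR addrC.
have [h1 h2] := key _ z erefl (etrans (esym (mem_dball _ _ _ _)) zr).
have EH : expR (E (d x0 z)) <= expR (1 + 5 * N%:R * B / c).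
  rewrite ler_expR /E; apply: lerD.
    by rewrite ler_pdivrMr // mul1r ler_nat -(mem_dball G).
  have -> : 5 * N%:R * B / c = r%:R / c * (5 * N%:R * B / r%:R).
    by field; rewrite !gt_eqF.
  rewrite ler_wpM2l ?divr_ge0 ?(ltW c_gt0) //.
  apply: le_trans (log_caccioppoli r0 vpos harm).
  rewrite big_mkcond big_seq [leRHS]big_seq; apply: ler_sum => x xW.
  by case: ifP; rewrite ?T0.
have vx := vpos x0 (le_W x0 (dball_center _ _ _)).
have vz := vpos z (le_W z zr).
split; [apply: le_trans h1 _ | apply: le_trans h2 _];
  by rewrite mulrC ler_wpM2r // ltW.
Qed.


End Harnack.

(** * Decay of the oscillation *)

Section Oscillation.
Variables (R : realType) (V : countType) (G : wgraph R V).
Local Notation d := (d0 G).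
Local Notation L := (laplacian G).
Implicit Types (x y z : V).

Variable H : R.
Hypothesis H_ge1 : 1 <= H.
Hypothesis harnackH : forall x0 (r : nat) (v : V -> R), (0 < r)%N ->
  (forall z, z \in dball G x0 (2 * r) -> 0 < v z) ->
  (forall z, (d x0 z < 2 * r)%N -> L v z = 0) ->
  forall z, z \in dball G x0 r -> v z <= H * v x0 /\ v x0 <= H * v z.

Variables (x0 : V) (f u : V -> R).
Hypothesis lip_f : Lip1 G f.
Local Notation h z := (f z - f x0).
Local Notation T := [pred z | `|f z - f x0| <= 1].

Definition osc_le (r : nat) (e : R) :=
  forall z z', z \in dball G x0 r -> z' \in dball G x0 r -> u z - u z' <= e.

(** Off the layer, steepness gives a neighbour at which [|h|] is smaller by exactly one. The descent
    reaches the layer, hence the ball of radius [r], within [|h z|] steps. *)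
Lemma far_from_layer (r rho : nat) z :
  (forall z, z \in dball G x0 (2 * rho) -> steep_at G f z) ->
  (forall z, z \in dball G x0 (2 * rho) -> T z -> z \in dball G x0 r) ->
  z \in dball G x0 rho -> (d x0 z)%:R <= `|h z| + r%:R.
Proof.
move=> steep hT zrho.
have : `|h z| <= rho%:R.
  apply: le_trans (Lip1_abs x0 z lip_f) _.
  by rewrite ler_nat -(mem_dball G).
have : (d x0 z + rho <= 2 * rho)%N.
  by rewrite mem_dball in zrho; lia.
(* The copy [n] of [rho] bounds the height left to descend and fits in the room left inside the ball
   of radius [2 * rho], where steepness is known. *)
elim: {1 3}rho z {zrho} => [|n IH] z dz hz.
  rewrite addn0 in dz; apply: le_trans (_ : r%:R <= _).
    by rewrite ler_nat -(mem_dball G) hT ?mem_dball //= (le_trans hz).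
  by rewrite lerDr.
have zr : z \in dball G x0 (2 * rho) by rewrite mem_dball; lia.
have [h1|h1] := leP `|h z| 1.
  apply: le_trans (_ : r%:R <= _); last by rewrite lerDr.
  by rewrite ler_nat -(mem_dball G) hT.
have [[y1 a1 e1] [y2 a2 e2]] := steep z zr.
have go y : adj G z y -> `|h y| = `|h z| - 1 -> (d x0 z)%:R <= `|h z| + r%:R.
  move=> a e; have t1 := d_triangle G z x0 y; have t2 := d_triangle G y x0 z.
  rewrite (d_adj a) in t1; rewrite (d_sym G y z) (d_adj a) in t2.
  have dy : (d x0 y + n <= 2 * rho)%N by lia.
  have hy : `|h y| <= n%:R by rewrite e; move: hz; rewrite -natr1; lra.
  have := IH y dy hy; move: t2; rewrite -(ler_nat R) natrD e; lra.
have [h0|h0] := lerP 0 (h z).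
  apply: go a2 _; rewrite e2; rewrite (ger0_norm h0) in h1 *.
  by rewrite ger0_norm; lra.
apply: go a1 _; rewrite e1; rewrite (ltr0_norm h0) in h1 *.
by rewrite ler0_norm; lra.
Qed.

(* [|f - f x0|] is harmonic off the layer [T] and at least [rho - r] on the
   sphere of radius [rho], hence a barrier for [u]; near [x0] it is at most
   [2 * r], and Harnack's inequality turns the upper bound on [u] into a bound
   on its oscillation. *)
Lemma oscillation_gap (r rho : nat) (e : R) :
  (forall z, z \in dball G x0 (2 * rho) -> L f z = 0 /\ steep_at G f z) ->
  (forall z, z \in dball G x0 (2 * rho) -> T z -> z \in dball G x0 r) ->
  (0 < r)%N -> (2 * r <= rho)%N -> (forall z, (d x0 z < rho)%N -> L u z = 0) ->
  0 < e -> osc_le rho e -> osc_le r (8 * H ^+ 2 * (r%:R / rho%:R) * e).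
Proof.
move=> fP hT r0 rrho harm e0 osc.
have steep z : z \in dball G x0 (2 * rho) -> steep_at G f z by move=> /fP[].
have far z := @far_from_layer r rho z steep hT.
have sub2 : {subset dball G x0 rho <= dball G x0 (2 * rho)}.
  by apply: sub_dball; rewrite leq_pmull.
have T0 : T x0 by rewrite /= subrr normr0.
have r0' : 0 < r%:R :> R by rewrite ltr0n.
have rrho' : 2 * r%:R <= rho%:R :> R by rewrite -natrM ler_nat.
(* With this slope the barrier reaches [e] on the sphere of radius [rho], where [|h|] is at least
   [rho - r]. *)
pose q := e / (rho%:R - r%:R).
have q0 : 0 < q by rewrite divr_gt0 // subr_gt0; lra.
have [zs] := @seq_argmax R V [seq z <- dball G x0 rho | T z] u x0
  ltac:(by rewrite mem_filter T0 dball_center).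
rewrite mem_filter => /andP[Tzs zsrho] zs_max.
have zsr : zs \in dball G x0 r by apply: hT => //; exact: sub2.
pose g z := u z - u zs - q * `|h z|.
have g_le z : z \in dball G x0 rho -> g z <= 0.
  have [z1 z1rho z1max] := seq_argmax g (dball_center G x0 rho).
  move=> /z1max /le_trans; apply; rewrite leNgt; apply/negP => P0.
  (* Maximum principle: a positive maximum of [g] would propagate along a geodesic to [x0], where
     [g <= 0]. *)
  suff no n z' : d x0 z' = n -> z' \in dball G x0 rho -> g z' = g z1 -> False.
    exact: (no _ z1 erefl z1rho erefl).
  elim: n z' => [|n IH] z' dz z'rho gz.
    rewrite -(d_eq0 dz) in gz.
    have : u x0 <= u zs by apply: zs_max; rewrite mem_filter T0 dball_center.
    by move: P0; rewrite -gz /g subrr normr0 mulr0; lra.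
  have nT : ~~ T z'.
    apply/negP => Tz.
    have : u z' <= u zs by apply: zs_max; rewrite mem_filter Tz.
    have : 0 <= q * `|h z'| by rewrite mulr_ge0 // ltW.
    by move: P0; rewrite -gz /g; lra.
  have dlt : (d x0 z' < rho)%N.
    rewrite ltn_neqAle -(mem_dball G) z'rho andbT; apply/eqP => dE.
    have := far _ z'rho; rewrite dE => hf.
    have : q * (rho%:R - r%:R) <= q * `|h z'| by rewrite ler_wpM2l ?(ltW q0) //; lra.
    have -> : q * (rho%:R - r%:R) = e.
      by rewrite /q divfK // gt_eqF // subr_gt0; lra.
    have := osc z' zs z'rho zsrho.
    by move: P0; rewrite -gz /g; lra.
  rewrite /= -ltNge in nT.
  have [y ay dy] := d_step_r dz.
  have yrho : y \in dball G x0 rho.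
    by rewrite mem_dball dy; rewrite dz in dlt; exact/ltnW/ltnW.
  (* Since [|h z'| > 1] and [f] is 1-Lipschitz, [h] keeps its sign on the neighbours of [z']; there
     [|h|] is a multiple of [h], hence harmonic at [z']. *)
  have [s sE] : exists s : R, forall y', y' = z' \/ adj G z' y' ->
      `|h y'| = s * h y'.
    have lip y' : adj G z' y' -> `|f y' - f z'| <= 1.
      by move=> a; have := Lip1_abs z' y' lip_f; rewrite (d_adj a).
    have [h0|h0] := lerP 0 (h z').
      exists 1 => y' [->|/lip]; first by rewrite mul1r ger0_norm.
      rewrite (ger0_norm h0) in nT; rewrite ler_norml mul1r => /andP[l1 l2].
      by rewrite ger0_norm //; lra.
    exists (-1) => y' [->|/lip]; first by rewrite mulN1r ltr0_norm.
    rewrite (ltr0_norm h0) in nT; rewrite ler_norml mulN1r => /andP[l1 l2].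
    by rewrite ltr0_norm //; lra.
  have Lg : L g z' = 0.
    rewrite (@eq_laplacian _ _ _ _ (fun y' =>
      (u y' + (- (q * s)) * f y') - (u zs - q * s * f x0))).
    - rewrite laplacianB laplacianD laplacianZ laplacian_cst harm //.
      by rewrite (fP z' (sub2 _ z'rho)).1; ring.
    - by rewrite /g sE; [ring | left].
    - by move=> y' a; rewrite /g sE; [ring | right].
  apply: (IH y dy yrho); rewrite -gz; apply/eqP.
  have le_nb y' : adj G z' y' -> g y' <= g z'.
    move=> a; rewrite gz; apply: z1max; rewrite mem_dball.
    apply: leq_trans (d_triangle G z' x0 y') _.
    by rewrite (d_adj a) addn1.
  have az : adj G z' y by rewrite adj_sym.
  rewrite eq_le le_nb //= leNgt; apply/negP => lt.
  have := @laplacian_gt0 _ _ G (fun z => - g z) z' y _ az.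
  rewrite laplacianN Lg oppr0 ltxx ltrN2 => F.
  suff: false by [].
  by apply: F lt => y' a; rewrite lerN2 le_nb.
pose c1 := 2 * r%:R * q.
have c10 : 0 < c1 by rewrite mulr_gt0 // mulr_gt0.
(* On the ball of radius [2 * r] the barrier is at most [c1]; the second [c1] makes [v] strictly
   positive. *)
pose v z := (u zs + 2 * c1) - u z.
have v_pos z : z \in dball G x0 (2 * r) -> 0 < v z.
  move=> z2r; have zrho : z \in dball G x0 rho by apply: sub_dball z2r.
  have : `|h z| <= 2 * r%:R.
    apply: le_trans (Lip1_abs x0 z lip_f) _.
    by rewrite -natrM ler_nat -(mem_dball G).
  move=> /(ler_wpM2l (ltW q0)); have := g_le z zrho.
  by move: c10; rewrite /g /v /c1; lra.
have v_harm z : (d x0 z < 2 * r)%N -> L v z = 0.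
  move=> dz; rewrite laplacianB laplacian_cst harm ?subr0 //.
  exact: leq_trans dz rrho.
have hv := harnackH r0 v_pos v_harm.
have x0r := dball_center G x0 r.
move=> z z' zr z'r.
have [_ b1] := hv zs zsr; have [b2 _] := hv z' z'r.
have vz : 0 < v z by apply: v_pos; apply: sub_dball zr; rewrite leq_pmull.
have vs : v zs = 2 * c1 by rewrite /v; ring.
have b3 : v z' <= H ^+ 2 * (2 * c1).
  apply: le_trans b2 _; rewrite expr2 -mulrA -vs ler_wpM2l //.
  exact: le_trans ler01 H_ge1.
have qle : q <= 2 * e / rho%:R.
  rewrite /q ler_pdivrMr; last by rewrite subr_gt0; lra.
  rewrite mulrAC ler_pdivlMr; last by lra.
  have : 0 <= e * (rho%:R - 2 * r%:R) by rewrite mulr_ge0 ?(ltW e0) // subr_ge0.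
  by lra.
have H20 : 0 <= H ^+ 2 by exact: sqr_ge0.
have : H ^+ 2 * (2 * c1) <= 8 * H ^+ 2 * (r%:R / rho%:R) * e.
  have -> : 8 * H ^+ 2 * (r%:R / rho%:R) * e
      = H ^+ 2 * (2 * (2 * r%:R * (2 * e / rho%:R))) by ring.
  apply: ler_wpM2l => //; apply: ler_wpM2l => //.
  by rewrite /c1 ler_wpM2l // mulr_ge0 // ltW.
by move: vz b3; rewrite /v; lra.
Qed.

Lemma osc_leW (k r : nat) (e e' : R) : (k <= r)%N -> e <= e' ->
  osc_le r e -> osc_le k e'.
Proof.
move=> kr ee' osc z z' zk z'k; apply: le_trans ee'.
by apply: osc; apply: sub_dball kr _ _.
Qed.

Variable s : nat.
Hypothesis fP : forall z, z \in dball G x0 s -> L f z = 0 /\ steep_at G f z.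
Hypothesis harm : forall z, (d x0 z < s)%N -> L u z = 0.

Let C0 := 32 * H ^+ 2.

(** Take [rho = t./2] in [oscillation_gap]: [t <= 4 * rho] costs a factor 4, which turns the 8 into
    the 32 of [C0]. For [t <= 4 * r] the new factor is at least 1 and monotonicity suffices. *)
Lemma oscillation_gap_le (r t : nat) (e : R) : (0 < r)%N -> (r <= t)%N ->
  (t <= s)%N -> (forall z, z \in dball G x0 t -> T z -> z \in dball G x0 r) ->
  0 < e -> osc_le t e -> osc_le r (C0 * (r%:R / t%:R) * e).
Proof.
move=> r0 rt ts hT e0 osc.
have t0 : 0 < t%:R :> R by rewrite ltr0n (leq_trans r0).
have H1 : 1 <= H ^+ 2 by rewrite exprn_ege1.
have [t4|t4] := leqP t (4 * r).
  apply: osc_leW rt _ osc.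
  have : 1 <= 4 * (r%:R / t%:R) :> R.
    by rewrite mulrA ler_pdivlMr // mul1r -natrM ler_nat.
  move=> h; rewrite ler_peMl ?(ltW e0) //.
  apply: le_trans h _; rewrite /C0 ler_wpM2r ?divr_ge0 ?(ltW t0) //.
  by lra.
pose rho := t./2.
have rho_t : (2 * rho <= t)%N by rewrite /rho; lia.
have le_t : (t <= 4 * rho)%N by rewrite /rho; lia.
have r_rho : (2 * r <= rho)%N by rewrite /rho; lia.
have subs z : z \in dball G x0 (2 * rho) -> z \in dball G x0 t.
  exact: sub_dball.
apply: (@osc_leW r r (8 * H ^+ 2 * (r%:R / rho%:R) * e)) => //.
  apply: ler_wpM2r; first exact: ltW.
  have rho0 : 0 < rho%:R :> R by rewrite ltr0n; lia.
  have -> : C0 * (r%:R / t%:R) = 8 * H ^+ 2 * (4 * r%:R / t%:R).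
    by rewrite /C0; ring.
  apply: ler_wpM2l; first by lra.
  rewrite ler_pdivlMr // mulrAC ler_pdivrMr //.
  have : r%:R * t%:R <= r%:R * (4 * rho%:R) :> R.
    by rewrite ler_wpM2l // -natrM ler_nat.
  by lra.
apply: oscillation_gap => //.
- by move=> z /subs zt; apply: fP; apply: sub_dball zt.
- by move=> z /subs; exact: hT.
- by move=> z dz; apply: harm; apply: leq_trans dz _; rewrite /rho; lia.
- by apply: osc_leW osc => //; rewrite /rho; lia.
Qed.

Let cnt (r : nat) := size [seq z <- dball G x0 r | T z].

Lemma cnt_mono (r t : nat) : (r <= t)%N -> (cnt r <= cnt t)%N.
Proof.
move=> rt; apply: uniq_leq_size; first exact/filter_uniq/dball_uniq.
by move=> z; rewrite !mem_filter => /andP[-> /(sub_dball rt)].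
Qed.

(** [t] is the least radius at which a new vertex of the layer appears, whence [t.-1] in the last
    clause. *)
Lemma next_layer_radius (r : nat) : (r <= s)%N ->
  (forall z, z \in dball G x0 s -> T z -> z \in dball G x0 r) \/
  exists t : nat, [/\ (r < t <= s)%N, (cnt r < cnt t)%N
    & forall z, z \in dball G x0 t.-1 -> T z -> z \in dball G x0 r].
Proof.
move=> rs; pose P j := has (fun z => T z && (z \notin dball G x0 r)) (dball G x0 j).
have [Ps|nPs] := boolP (P s); last first.
  left => z zs Tz; apply: contraNT nPs => zr.
  by apply/hasP; exists z => //; rewrite Tz.
right; have [t Pt t_min] := ex_minnP (ex_intro _ s Ps : exists j, P j).
have [z zt /andP[Tz zr]] := hasP Pt.
have rt : (r < t)%N.
  by rewrite ltnNge; apply: contraNN zr => tr; exact: sub_dball tr _ zt.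
exists t; split; first by rewrite rt t_min.
  apply: (@uniq_leq_size _ (z :: [seq z <- dball G x0 r | T z])).
    by rewrite /= mem_filter (negbTE zr) andbF /=; exact/filter_uniq/dball_uniq.
  move=> y; rewrite inE !mem_filter => /predU1P[->|/andP[-> yr]].
    by rewrite Tz.
  exact: sub_dball (ltnW rt) _ yr.
move=> y yt Ty; apply: contraTT isT => yr /=.
have : P t.-1 by apply/hasP; exists y => //; rewrite Ty.
by move=> /t_min; lia.
Qed.

(* Between two consecutive radii at which the balls around [x0] meet new
   vertices of the layer, [oscillation_gap_le] loses a constant only once. *)
Lemma oscillation_decay (n r : nat) (e : R) : (0 < r)%N -> (r <= s)%N ->
  (cnt s <= cnt r + n)%N -> 0 < e -> osc_le s e ->
  osc_le r ((2 * C0) ^+ n.+1 * (r%:R / s%:R) * e).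
Proof.
move=> + + + e0 osc.
have H1 : 1 <= H ^+ 2 by rewrite exprn_ege1.
have C1 : 1 <= 2 * C0 by rewrite /C0; lra.
have base k r1 : (0 < r1)%N -> (r1 <= s)%N ->
    (forall z, z \in dball G x0 s -> T z -> z \in dball G x0 r1) ->
    osc_le r1 ((2 * C0) ^+ k.+1 * (r1%:R / s%:R) * e).
  move=> r0 rs hT; apply: (osc_leW (leqnn r1) _
    (oscillation_gap_le r0 rs (leqnn s) hT e0 osc)).
  rewrite ler_wpM2r ?(ltW e0) // ler_wpM2r ?divr_ge0 //.
  apply: (@le_trans _ _ (2 * C0)); first lra.
  by rewrite exprS ler_peMr ?exprn_ege1 //; lra.
elim: n r => [|n IH] r r0 rs hn.
  have [|[t [/andP[rt ts] lt_cnt _]]] := next_layer_radius rs.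
    exact: base r0 rs.
  by have := cnt_mono ts; lia.
have [|[t [/andP[rt ts] lt_cnt hT]]] := next_layer_radius rs.
  exact: base r0 rs.
have s0 : 0 < s%:R :> R by rewrite ltr0n (leq_trans r0).
have t0 : (0 < t)%N by exact: leq_trans r0 (ltnW rt).
have IHt := IH t t0 ts ltac:(lia).
have t0' : 0 < t%:R :> R by rewrite ltr0n.
have t1 : 0 < t.-1%:R :> R by rewrite ltr0n; lia.
set e' := _ * e in IHt.
have e'0 : 0 < e'.
  by rewrite /e' !mulr_gt0 ?invr_gt0 ?exprn_gt0 //; lra.
have rt1 : (r <= t.-1)%N by lia.
have t1s : (t.-1 <= s)%N by lia.
have osc' : osc_le t.-1 e' by apply: osc_leW IHt => //; lia.
apply: osc_leW (leqnn r) _ (oscillation_gap_le r0 rt1 t1s hT e'0 osc').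
(* The gap was applied at radius [t.-1]; as [t >= 2], returning to [t] costs the factor 2 in
   [2 * C0]. *)
have -> : (2 * C0) ^+ n.+2 * (r%:R / s%:R) * e = C0 * (2 * r%:R / t%:R) * e'.
  by rewrite /e' [in LHS]exprS; field; rewrite !gt_eqF.
rewrite ler_wpM2r ?(ltW e'0) // ler_wpM2l //; first lra.
rewrite ler_pdivrMr // mulrAC ler_pdivlMr //.
have : r%:R * t%:R <= r%:R * (2 * t.-1%:R) :> R.
  by rewrite ler_wpM2l // -natrM ler_nat; lia.
by lra.
Qed.

End Oscillation.

(** * The gradient at a vertex and the final estimate *)

Section Gradient.
Variables (R : realType) (V : countType) (G : wgraph R V).

Lemma gradient_le (u : V -> R) (x : V) (b : R) : 0 <= b ->
  (forall y, adj G x y -> `|u y - u x| <= b) -> gradient G u x <= b.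
Proof.
move=> b0 h; rewrite /gradient big_seq; apply: bigmax_le => // y.
by rewrite -/(nbrs G x) mem_nbrs => /h.
Qed.

(** At a harmonic vertex the weighted sum over the neighbours equals [vmeas G x * degree G x * u x],
    which bounds each of its non-negative terms. This settles small radii. *)
Lemma harmonic_neighbor_le (u : V -> R) (x y : V) (c B : R) : 0 < c ->
  c <= weight G x y -> vmeas G x * degree G x <= B ->
  laplacian G u x = 0 -> 0 <= u x -> (forall z, adj G x z -> 0 <= u z) ->
  adj G x y -> u y <= B / c * u x.
Proof.
move=> c0 cw hB Lu ux uz a.
have mi := lt0r_neq0 (vmeas_inv_gt0 G x).
have E : \sum_(z <- nbrs G x) weight G x z * u z
    = vmeas G x * degree G x * u x.
  move: Lu; rewrite laplacian_nbrs => /eqP; rewrite mulf_eq0 (negbTE mi) /=.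
  under eq_bigr do rewrite mulrBr.
  rewrite sumrB -mulr_suml subr_eq0 => /eqP ->.
  rewrite (degreeE (nbrs_uniq G x)) // mulrA mulfV ?mul1r //.
  by rewrite lt0r_neq0 ?vmeas_gt0.
have : weight G x y * u y <= B * u x.
  apply: le_trans (_ : vmeas G x * degree G x * u x <= _).
    rewrite -E (bigD1_seq y) ?nbrs_uniq ?mem_nbrs //= lerDl.
    rewrite big_seq_cond sumr_ge0 // => z /andP[]; rewrite mem_nbrs => /uz h _.
    by rewrite mulr_ge0 ?weight_ge0.
  by rewrite ler_wpM2r.
rewrite mulrAC ler_pdivlMr // mulrC => le; apply: le_trans le.
by rewrite ler_wpM2l ?uz.
Qed.

End Gradient.

Lemma half_bounds (n : nat) : (2 <= n)%N ->
  [/\ (0 < n./2)%N, (2 * n./2 <= n)%N & (n.+1 <= 4 * n./2)%N].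
Proof. by move=> n2; split; lia. Qed.

Theorem theorem5p9 (R : realType) (V : countType) (G : wgraph R V) :
  salami G -> bounded_geometry G ->
  exists C : R, forall (x0 : V) (r : R) (u : V -> R),
    0 < r -> positive_harmonic G x0 r u ->
    gradient G u x0 <= C / r * u x0.
Proof.
move=> sal [c [D [/andP[c0 cD] bg]]].
have D0 : 0 < D by exact: lt_trans cD.
have curv : nonneg_ollivier G by case: sal.
have degD x : degree G x <= D.
  by have [y /bg[_ _ lt]] := exists_adj sal x; exact: ltW.
have wc x y : adj G x y -> c <= weight G x y.
  by move=> /bg[_ /andP[lt _] _]; exact: ltW.
pose B := D * D.
have B0 : 0 <= B by rewrite mulr_ge0 ?ltW.
have flow x : vmeas G x * degree G x <= B.
  have [y /bg[/andP[_ mD] _ /ltW dD]] := exists_adj sal x.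
  by apply: ler_pM => //; [exact/ltW/vmeas_gt0 | exact: degree_ge0 | exact: ltW].
have [N hN] := salami_height curv degD D0 c0 wc sal.
have growth x n : (size (dball G x n) <= N * (2 * n).+1)%N.
  have [f [lf _ hf]] := hN x n.
  apply: (@size_layers R V f _ N (f x - n%:R)); first exact: dball_uniq.
    exact: hf.
  move=> z; rewrite mem_dball => zn.
  have := Lip1_abs x z lf; have : (d0 G x z)%:R <= n%:R :> R by rewrite ler_nat.
  by rewrite natrM ler_norml; lra.
have [H H1 harn] := harnack c0 wc B0 flow growth.
(* The layer [|f - f x0| <= 1] has height 2, hence at most [N * 3] vertices, which bounds how often
   new ones appear. *)
pose C1 := (2 * (32 * H ^+ 2)) ^+ (N * 3).+1 * H.
have C10 : 0 <= C1.
  have H0 : 0 <= H by exact: le_trans H1.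
  by rewrite /C1 mulr_ge0 // exprn_ge0 // mulr_ge0 // mulr_ge0 // sqr_ge0.
have Bc : 0 <= B / c by rewrite divr_ge0 // ltW.
(* The first summand serves radii below 2, the second all others, where [r <= 4 * s]. *)
exists (2 * (B / c + 1) + 4 * C1) => x0 r u r0 [upos uharm].
have inball (n : nat) z : n%:R <= r + 1 -> z \in dball G x0 n -> 0 < u z.
  rewrite mem_dball => nr zn; apply: upos; rewrite /Defs.ball0 /mkset.
  by apply: le_trans nr; rewrite ler_nat.
have ux : 0 < u x0.
  by apply: (inball 0%N); [lra | exact: dball_center].
have [r2|r2] := ltP r 2.
  apply: gradient_le => [|y a].
    rewrite mulr_ge0 ?(ltW ux) // divr_ge0 ?(ltW r0) //; lra.
  have Lu : laplacian G u x0 = 0 by apply: uharm; rewrite /Defs.ball0 /mkset dxx ltW.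
  have unb z : adj G x0 z -> 0 <= u z.
    move=> az; apply/ltW/(inball 1%N); first by lra.
    by rewrite mem_dball (d_adj az).
  have := harmonic_neighbor_le c0 (wc _ _ a) (flow x0) Lu (ltW ux) unb a.
  have := unb y a => uy le.
  apply: (@le_trans _ _ ((B / c + 1) * u x0)).
    have : 0 <= B / c * u x0 by rewrite mulr_ge0 // ltW.
    by rewrite ler_norml; lra.
  rewrite ler_wpM2r ?(ltW ux) // ler_pdivlMr //.
  have : (B / c + 1) * r <= (B / c + 1) * 2 by rewrite ler_wpM2l ?(ltW r2) //; lra.
  by lra.
(* Harnack's inequality on radius [s] needs the ball of radius [2 * s], which thus stays inside that
   of radius [r]. *)
pose n := Num.trunc r; pose s := n./2.
have nr : n%:R <= r by have /andP[] := truncn_itv (ltW r0).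
have rn : r < n.+1%:R := truncnS_gt r.
have n2 : (2 <= n)%N by rewrite -ltnS -(ltr_nat R); apply: le_lt_trans rn.
have [s0 sn ns] : [/\ (0 < s)%N, (2 * s <= n)%N & (n.+1 <= 4 * s)%N].
  exact: half_bounds.
have rs : r <= 4 * s%:R.
  by apply: le_trans (ltW rn) _; rewrite -natrM ler_nat.
have pos2s z : z \in dball G x0 (2 * s) -> 0 < u z.
  move=> zs; apply: (inball (2 * s)%N) zs.
  by apply: (@le_trans _ _ n%:R); [rewrite ler_nat | lra].
have harm2s z : (d0 G x0 z < 2 * s)%N -> laplacian G u z = 0.
  move=> zs; apply: uharm; rewrite /Defs.ball0 /mkset; apply: le_trans nr.
  by rewrite ler_nat; exact: leq_trans (ltnW zs) sn.
have harn_u z : z \in dball G x0 s -> u z <= H * u x0.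
  by move=> zs; case: (harn x0 s u s0 pos2s harm2s z zs).
have [f [lf fP hf]] := hN x0 s.
have e0 : 0 < H * u x0 by rewrite mulr_gt0 //; lra.
(* By positivity of [u] the oscillation is at most the upper Harnack bound. *)
have osc : osc_le G x0 u s (H * u x0).
  move=> z z' zs z's; have := harn_u z zs.
  have : 0 < u z' by apply: pos2s; apply: sub_dball z's; rewrite leq_pmull.
  by lra.
have harms z : (d0 G x0 z < s)%N -> laplacian G u z = 0.
  by move=> zs; apply: harm2s; apply: leq_trans zs _; rewrite leq_pmull.
pose T z := `|f z - f x0| <= 1.
have cnt : (size [seq z <- dball G x0 s | T z] <=
    size [seq z <- dball G x0 1 | T z] + N * 3)%N.
  apply: leq_trans (leq_addl _ _).
  apply: (@size_layers R V f _ N (f x0 - 1) 2).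
  - exact/filter_uniq/dball_uniq.
  - move=> t A uA sA; apply: hf => // z /sA.
    by rewrite mem_filter => /andP[].
  - by move=> z; rewrite mem_filter /T ler_norml => /andP[/andP[h1 h2] _]; lra.
(* The decay is read off at radius 1, where the ball consists of [x0] and its neighbours. *)
have dec := oscillation_decay H1 harn lf fP harms (ltn0Sn 0) s0 cnt e0 osc.
have s0' : 0 < s%:R :> R by rewrite ltr0n.
apply: (@le_trans _ _ (C1 / s%:R * u x0)); last first.
  rewrite ler_wpM2r ?(ltW ux) // ler_pdivrMr // mulrAC ler_pdivlMr //.
  have : C1 * r <= C1 * (4 * s%:R) by rewrite ler_wpM2l.
  have : 0 <= 2 * (B / c + 1) * s%:R by rewrite !mulr_ge0 //; lra.
  by lra.
apply: gradient_le => [|y a].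
  by apply: mulr_ge0 (ltW ux); apply: divr_ge0 C10 (ltW s0').
have y1 : y \in dball G x0 1 by rewrite mem_dball (d_adj a).
have x1 := dball_center G x0 1.
have CE : C1 / s%:R * u x0 =
    (2 * (32 * H ^+ 2)) ^+ (N * 3).+1 * (1%:R / s%:R) * (H * u x0).
  by rewrite /C1; ring.
by rewrite ler_norml CE; have := dec y x0 y1 x1; have := dec x0 y x1 y1; lra.
Qed.
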